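(* Let $K$ be an algebraically closed field and let $A=KQ/I$ be an indecomposable finite dimensional $K$-algebra, where $Q$ is a quiver and $I$ is an admissible ideal of the path algebra $KQ$, such that $\operatorname{rad}(A)^2\neq 0$. Then $A$ is a symmetric special multiserial algebra if and only if $A$ is (isomorphic to) a Brauer configuration algebra.
   Context: Paths are written left to right: $ab$ is the path $a$ followed by $b$ (and $ab=0$ in $KQ$ if not composable). A finite dimensional $K$-algebra $A$ is symmetric if there is a $K$-linear form $f\colon A\to K$ with $f(xy)=f(yx)$ for all $x,y\in A$ such that $\ker(f)$ contains no nonzero two-sided ideal of $A$. A finite dimensional $K$-algebra is special multiserial if it is Morita equivalent to a quotient $KQ'/I'$ of a path algebra by an admissible ideal such that for every arrow $a$ in $Q'$ there is at most one arrow $b$ with $ab\notin I'$ and at most one arrow $c$ with $ca\notin I'$. A (reduced) Brauer configuration is a tuple $\Gamma=(\Gamma_0,\Gamma_1,\mu,\mathfrak o)$ where $\Gamma_0$ is a finite set of vertices; $\Gamma_1$ is a finite collection of finite multisets of vertices, called polygons; $\mu\colon\Gamma_0\to\{1,2,3,\dots\}$ is a function (the multiplicity function); and $\mathfrak o$ is an orientation. For $\alpha\in\Gamma_0$, $\operatorname{val}(\alpha)$ is the sum over all polygons $V\in\Gamma_1$ of the number of times $\alpha$ occurs in $V$. A vertex $\alpha$ is truncated if it occurs once in exactly one polygon and $\mu(\alpha)=1$, i.e. $\operatorname{val}(\alpha)\mu(\alpha)=1$. The orientation $\mathfrak o$ is, for each nontruncated vertex $\alpha$, a choice of cyclic ordering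 $V_1<V_2<\cdots<V_{\operatorname{val}(\alpha)}\ (<V_1)$ of the polygons containing $\alpha$, counted with repetitions (a polygon containing $\alpha$ exactly $t$ times appears $t$ times); $V_{r+1}$ is called the successor of $V_r$ at $\alpha$ (indices modulo $\operatorname{val}(\alpha)$). One requires: (C1) every vertex lies in at least one polygon; (C2) every polygon has at least two vertices (counted with repetition); (C3) every polygon contains at least one vertex $\alpha$ with $\operatorname{val}(\alpha)\mu(\alpha)>1$; (C4) if a truncated vertex $\alpha$ lies in a polygon $V$, then $V$ is a 2-gon. The quiver $Q_\Gamma$ has one vertex $v$ for each polygon $V\in\Gamma_1$. For each nontruncated $\alpha$ with cyclic ordering $V_1<\cdots<V_m$, $m=\operatorname{val}(\alpha)$, there are arrows $a_1,\dots,a_m$, where $a_r$ goes from $v_r$ to $v_{r+1}$ (with $v_{m+1}=v_1$); the arrows obtained from all nontruncated vertices in this way are pairwise distinct and are all the arrows of $Q_\Gamma$. For such $\alpha$ let $C_j=a_ja_{j+1}\cdots a_m a_1\cdots a_{j-1}$. If $\alpha$ occurs in $V$ and $V=V_{i_1},\dots,V=V_{i_t}$ are all its occurrences in the cyclic ordering at $\alpha$, then the cycles $C_{i_1},\dots,C_{i_t}$ are the special $\alpha$-cycles at $v$. A special cycle is a special $\alpha$-cycle at some $v$ for some $\alpha$. The set $\rho_\Gamma$ consists of: (type one) all $C^{\mu(\alpha)}-(C')^{\mu(\beta)}$ where $V\in\Gamma_1$, $\alpha,\beta$ are (possibly equal) nontruncated vertices in $V$, $C$ is a special $\alpha$-cycle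 at $v$ and $C'$ is a special $\beta$-cycle at $v$; (type two) all paths $C^{\mu(\alpha)}a_1$ where $C=a_1\cdots a_m$ is a special $\alpha$-cycle; (type three) all paths $ab$ of length 2 in $Q_\Gamma$ that are not a subpath of any special cycle, except the paths $aa$ where $a$ is the loop associated to a vertex $\alpha$ with $\operatorname{val}(\alpha)=1$ and $\mu(\alpha)>1$. The Brauer configuration algebra associated to $\Gamma$ is $KQ_\Gamma/I_\Gamma$, where $I_\Gamma$ is the ideal generated by $\rho_\Gamma$. *)

(* Defs.v *)
From HB Require Import structures.
From mathcomp Require Import all_boot all_algebra finmap multiset.
From mathcomp Require Import all_classical.
From mathcomp Require Import monalg.

Set Implicit Arguments.
Unset Strict Implicit.
Unset Printing Implicit Defensive.

Import GRing.Theory.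

Local Open Scope classical_set_scope.
Local Open Scope ring_scope.

Definition alg_iso (K : pzRingType) (A B : algType K) : Prop :=
  exists f : {lrmorphism A -> B}, bijective f.

(* objects of [algType K] are nonzero, so [A], [B], [C] all are *)
Definition indecomposable (K : pzRingType) (A : algType K) : Prop :=
  forall B C : algType K, ~ alg_iso A (B * C)%type.

Definition finite_dim (K : pzRingType) (V : lmodType K) : Prop :=
  exists s : seq V, forall v : V,
    exists c : 'I_(size s) -> K, v = \sum_i c i *: s`_i.

Section Ideals.
Variable R : pzRingType.
Implicit Types J : set R.

Definition is_left_ideal J : Prop :=
  [/\ J 0, (forall x y, J x -> J y -> J (x + y)) &
      forall a x, J x -> J (a * x)].

Definition is_ideal J : Prop :=
  is_left_ideal J /\ forall a x, J x -> J (x * a).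

(* proper two-sided ideals: the quotient has to be a nonzero ring for [algType] *)
Record two_sided_ideal := TwoSidedIdeal {
  ideal_set :> set R;
  ideal_setP : is_ideal ideal_set;
  ideal_proper : ~ ideal_set 1 }.

Definition ideal_gen (S : set R) : set R := smallest is_ideal S.

Lemma ideal_genP S : is_ideal (ideal_gen S).
Proof.
split; first split.
- by move=> J [[[]]].
- by move=> x y Jx Jy J JP; case: (JP) => -[[_ D _] _] _; apply: D;
    [exact: Jx | exact: Jy].
- by move=> a x Jx J JP; case: (JP) => -[[_ _ M] _] _; apply: M; exact: Jx.
- by move=> a x Jx J JP; case: (JP) => -[_ M] _; apply: M; exact: Jx.
Qed.

Definition ideal_mul (J1 J2 : set R) : set R :=
  [set x | exists s : seq (R * R),
     (forall u, u \in s -> J1 u.1 /\ J2 u.2) /\ x = \sum_(u <- s) u.1 * u.2].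

Definition ideal_exp J n : set R := iter n (ideal_mul J) setT.

Definition maximal_left_ideal J : Prop :=
  [/\ is_left_ideal J, J != setT &
      forall J', is_left_ideal J' -> J `<=` J' -> J' = J \/ J' = setT].

Definition jacobson_rad : set R := \bigcap_(J in maximal_left_ideal) J.

End Ideals.

Section QuotientAlgebra.
Variables (K : pzRingType) (A : algType K) (I : two_sided_ideal A).

Definition ideal_pred : {pred A} := [pred x | `[< ideal_set I x >]].

Fact ideal_pred_zmod_closed : zmod_closed ideal_pred.
Proof.
have [[I0 ID IM] _] := ideal_setP I.
split=> [|x y /asboolP Ix /asboolP Iy]; first exact/asboolP.
by apply/asboolP; apply: ID => //; rewrite -mulN1r; exact: IM.
Qed.

HB.instance Definition _ := GRing.isZmodClosed.Build A ideal_pred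
  ideal_pred_zmod_closed.

Definition quot_alg : Type := Quotient.quot ideal_pred.
HB.instance Definition _ := GRing.Zmodule.on quot_alg.

Definition qproj (x : A) : quot_alg := \pi_(Quotient.quot ideal_pred)%qT x.
Definition qrepr (x : quot_alg) : A := repr (x : Quotient.quot ideal_pred).

Lemma qreprK : cancel qrepr qproj.
Proof. by move=> x; exact: reprK. Qed.

Lemma qproj_eq x y : qproj x = qproj y <-> ideal_set I (x - y).
Proof.
split=> [/eqP|Ixy]; first by rewrite -Quotient.idealrBE => /asboolP.
by apply/eqP; rewrite -Quotient.idealrBE; exact/asboolP.
Qed.

Lemma qreprP x : ideal_set I (x - qrepr (qproj x)).
Proof. by apply/qproj_eq; rewrite qreprK. Qed.

Lemma qprojD x y : qproj (x + y) = qproj x + qproj y.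
Proof. by rewrite /qproj !piE. Qed.

Definition qone : quot_alg := qproj 1.
Definition qmul (x y : quot_alg) : quot_alg := qproj (qrepr x * qrepr y).
Definition qscale (k : K) (x : quot_alg) : quot_alg := qproj (k *: qrepr x).

Lemma qprojM x y : qproj (x * y) = qmul (qproj x) (qproj y).
Proof.
have [[I0 ID IMl] IMr] := ideal_setP I.
apply/qproj_eq; set x' := qrepr _; set y' := qrepr _.
rewrite -[X in X - _](subrK (x' * y)) -addrA -mulrBl -mulrBr.
by apply: ID; [apply: IMr; exact: qreprP | apply: IMl; exact: qreprP].
Qed.

Lemma qprojZ k x : qproj (k *: x) = qscale k (qproj x).
Proof.
have [[I0 ID IMl] IMr] := ideal_setP I.
apply/qproj_eq; rewrite -scalerBr -[_ - _]mul1r scalerAl.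
by apply: IMl; exact: qreprP.
Qed.

Let qrep x : x = qproj (qrepr x) := esym (qreprK x).

Fact qmulA : associative qmul.
Proof.
by move=> x y z; rewrite (qrep x) (qrep y) (qrep z) -!qprojM mulrA.
Qed.
Fact qmul1 : left_id qone qmul.
Proof. by move=> x; rewrite (qrep x) -!qprojM mul1r. Qed.
Fact qmulr1 : right_id qone qmul.
Proof. by move=> x; rewrite (qrep x) -!qprojM mulr1. Qed.
Fact qmulDl : left_distributive qmul +%R.
Proof.
move=> x y z; rewrite (qrep x) (qrep y) (qrep z).
by rewrite -qprojD -!qprojM -qprojD mulrDl.
Qed.
Fact qmulDr : right_distributive qmul +%R.
Proof.
move=> x y z; rewrite (qrep x) (qrep y) (qrep z).
by rewrite -qprojD -!qprojM -qprojD mulrDr.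
Qed.

Fact qone_neq0 : qone != 0.
Proof.
apply/eqP=> q10; apply: (@ideal_proper _ I).
have /qproj_eq : qproj 1 = qproj 0 by rewrite -[LHS]/qone q10 /qproj !piE.
by rewrite subr0.
Qed.

HB.instance Definition _ := GRing.Zmodule_isNzRing.Build quot_alg
  qmulA qmul1 qmulr1 qmulDl qmulDr qone_neq0.

Fact qscaleA k l x : qscale k (qscale l x) = qscale (k * l) x.
Proof. by rewrite (qrep x) -!qprojZ scalerA. Qed.
Fact qscale1 : left_id 1 qscale.
Proof. by move=> x; rewrite (qrep x) -!qprojZ scale1r. Qed.
Fact qscaleDr : right_distributive qscale +%R.
Proof.
move=> k x y; rewrite (qrep x) (qrep y).
by rewrite -qprojD -!qprojZ -qprojD scalerDr.
Qed.
Fact qscaleDl x : {morph qscale^~ x : k l / k + l}.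
Proof. by move=> k l; rewrite (qrep x) -!qprojZ -qprojD scalerDl. Qed.

HB.instance Definition _ := GRing.Zmodule_isLmodule.Build K quot_alg
  qscaleA qscale1 qscaleDr qscaleDl.

Fact qscalerAl (k : K) (x y : quot_alg) : k *: (x * y) = (k *: x) * y.
Proof.
rewrite (qrep x) (qrep y).
by rewrite /GRing.mul/GRing.scale/= -qprojM -!qprojZ -qprojM scalerAl.
Qed.
Fact qscalerAr (k : K) (x y : quot_alg) : k *: (x * y) = x * (k *: y).
Proof.
rewrite (qrep x) (qrep y).
by rewrite /GRing.mul/GRing.scale/= -qprojM -!qprojZ -qprojM scalerAr.
Qed.

HB.instance Definition _ :=
  GRing.Lmodule_isLalgebra.Build K quot_alg qscalerAl.
HB.instance Definition _ :=
  GRing.Lalgebra_isAlgebra.Build K quot_alg qscalerAr.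

End QuotientAlgebra.

(* the empty quiver is excluded since its path algebra is zero *)
Record quiver := Quiver {
  qvert : finType;
  qarrow : finType;
  src : qarrow -> qvert;
  tgt : qarrow -> qvert;
  qvert_gt0 : (0 < #|qvert|)%N }.

Section Paths.
Variable Q : quiver.

Fixpoint walk (v : qvert Q) (s : seq (qarrow Q)) : bool :=
  if s is a :: s' then (src a == v) && walk (tgt a) s' else true.

(* start vertex and arrows read from left to right; the empty sequence gives
   the trivial path at the start vertex *)
Record qpath := QPath {
  qpval :> qvert Q * seq (qarrow Q); _ : walk qpval.1 qpval.2 }.
HB.instance Definition _ := [isSub for qpval].
HB.instance Definition _ := [Choice of qpath by <:].

Definition pstart (p : qpath) : qvert Q := p.1.
Definition pend (p : qpath) : qvert Q := last p.1 [seq tgt a | a <- p.2].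

Definition triv_path (v : qvert Q) : qpath := @QPath (v, [::]) isT.

Fact arrow_path_subproof (a : qarrow Q) : walk (src a) [:: a].
Proof. by rewrite /= eqxx. Qed.
Definition arrow_path (a : qarrow Q) : qpath :=
  @QPath (src a, [:: a]) (arrow_path_subproof a).

Lemma walk_cat v s t :
  walk v (s ++ t) = walk v s && walk (last v [seq tgt a | a <- s]) t.
Proof. by elim: s v => //= a s IHs v; rewrite IHs andbA. Qed.

Definition pcat (p q : qpath) : option qpath :=
  if pend p == pstart q then insub (p.1, p.2 ++ q.2) else None.

Lemma pcatT p q : pend p = pstart q ->
  exists2 r, pcat p q = Some r & val r = (p.1, p.2 ++ q.2).
Proof.
move=> pq; rewrite /pcat pq eqxx.
have w : walk (p.1, p.2 ++ q.2).1 (p.1, p.2 ++ q.2).2.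
  rewrite /= walk_cat (valP p) -[last _ _]/(pend p) pq; exact: (valP q).
by rewrite insubT; eexists.
Qed.

Lemma pcatF p q : pend p <> pstart q -> pcat p q = None.
Proof. by move=> /eqP pq; rewrite /pcat (negbTE pq). Qed.

Lemma pcat_assoc (p q r : qpath) :
  obind (fun x => pcat x r) (pcat p q) = obind (pcat p) (pcat q r).
Proof.
have [pq|/eqP pq] := eqVneq (pend p) (pstart q); last first.
  rewrite (pcatF pq) /=.
  have [qr|/eqP qr] := eqVneq (pend q) (pstart r); last by rewrite (pcatF qr).
  have [x -> vx] := pcatT qr; by rewrite /= pcatF // /pstart vx.
have [x -> vx] := pcatT pq.
have ex : pend x = pend q.
  by rewrite /pend vx /= map_cat last_cat -[last p.1 _]/(pend p) pq.
have [qr|/eqP qr] := eqVneq (pend q) (pstart r); last first.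
  by rewrite (pcatF qr) /= pcatF // ex.
have [y -> vy] := pcatT qr.
have [|z ez vz] := @pcatT x r; first by rewrite ex.
rewrite /= {}ez.
have [|t -> vt] := @pcatT p y; first by rewrite pq /pstart vy.
have /val_inj -> // : val z = val t by rewrite vz vt vx vy /= catA.
Qed.

End Paths.

(* The operations are locked so that failed unification does not unfold them
   down to the underlying formal sums. *)
Definition path_alg (K : fieldType) (Q : quiver) : Type := {malg K[qpath Q]}.
HB.instance Definition _ (K : fieldType) (Q : quiver) :=
  GRing.Zmodule.on (path_alg K Q).

HB.lock Definition pa_scale (K : fieldType) (Q : quiver) (k : K)
  (f : path_alg K Q) : path_alg K Q := k *: (f : {malg K[qpath Q]}).

Section PathModule.
Variables (K : fieldType) (Q : quiver).

Fact pa_scaleA k l (f : path_alg K Q) :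
  pa_scale k (pa_scale l f) = pa_scale (k * l) f.
Proof. by rewrite pa_scale.unlock scalerA. Qed.
Fact pa_scale1 : left_id 1 (@pa_scale K Q).
Proof. by move=> f; rewrite pa_scale.unlock scale1r. Qed.
Fact pa_scaleDr : right_distributive (@pa_scale K Q) +%R.
Proof. by move=> k f g; rewrite pa_scale.unlock scalerDr. Qed.
Fact pa_scaleDl (f : path_alg K Q) : {morph (@pa_scale K Q)^~ f : k l / k + l}.
Proof. by move=> k l; rewrite pa_scale.unlock scalerDl. Qed.

HB.instance Definition _ := GRing.Zmodule_isLmodule.Build K (path_alg K Q)
  pa_scaleA pa_scale1 pa_scaleDr pa_scaleDl.

Lemma pa_coefZ k (f : path_alg K Q) p : (k *: f)@_p = k * f@_p.
Proof. by rewrite /GRing.scale/= pa_scale.unlock mcoeffZ. Qed.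

Lemma pa_suppZ_le k (f : path_alg K Q) : (msupp (k *: f) `<=` msupp f)%fset.
Proof. by rewrite /GRing.scale/= pa_scale.unlock msuppZ_le. Qed.

End PathModule.

HB.lock Definition path_elt (K : fieldType) (Q : quiver) (p : qpath Q) :
  path_alg K Q := << p >>.

Definition path_mul (K : fieldType) (Q : quiver) (p q : qpath Q) :
    path_alg K Q :=
  if pcat p q is Some r then path_elt K r else 0.

HB.lock Definition pa_mul (K : fieldType) (Q : quiver) (f g : path_alg K Q) :
  path_alg K Q :=
  \sum_(p <- msupp f) \sum_(q <- msupp g) (f@_p * g@_q) *: path_mul K p q.

Section PathAlgebra.
Variables (K : fieldType) (Q : quiver).
Local Notation path_alg := (path_alg K Q).
Local Notation path_elt := (@path_elt K Q).
Local Notation path_mul := (@path_mul K Q).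
Local Notation pa_mul := (@pa_mul K Q).

Definition pa_one : path_alg := \sum_(v : qvert Q) path_elt (triv_path v).

Lemma pa_mulEw (f g : path_alg) (df dg : {fset qpath Q}) :
  (msupp f `<=` df)%fset -> (msupp g `<=` dg)%fset ->
  pa_mul f g = \sum_(p <- df) \sum_(q <- dg) (f@_p * g@_q) *: path_mul p q.
Proof.
move=> sf sg; rewrite pa_mul.unlock (big_fset_incl _ sf) /=; last first.
  move=> p _ /mcoeff_outdom ->.
  by rewrite big1 // => q _; rewrite mul0r scale0r.
apply: eq_bigr => p _; apply: (big_fset_incl _ sg) => q _ /mcoeff_outdom ->.
by rewrite mulr0 scale0r.
Qed.

Fact pa_mulDl : left_distributive pa_mul +%R.
Proof.
move=> f g h; set d := (msupp f `|` msupp g)%fset.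
rewrite (@pa_mulEw (f + g) h d (msupp h)) ?msuppD_le //.
rewrite (@pa_mulEw f h d (msupp h)) ?fsubsetUl //.
rewrite (@pa_mulEw g h d (msupp h)) ?fsubsetUr //.
rewrite -big_split; apply: eq_bigr => p _; rewrite -big_split.
by apply: eq_bigr => q _ /=; rewrite mcoeffD mulrDl scalerDl.
Qed.

Fact pa_mulDr : right_distributive pa_mul +%R.
Proof.
move=> f g h; set d := (msupp g `|` msupp h)%fset.
rewrite (@pa_mulEw f (g + h) (msupp f) d) ?msuppD_le //.
rewrite (@pa_mulEw f g (msupp f) d) ?fsubsetUl //.
rewrite (@pa_mulEw f h (msupp f) d) ?fsubsetUr //.
rewrite -big_split; apply: eq_bigr => p _; rewrite -big_split.
by apply: eq_bigr => q _ /=; rewrite mcoeffD mulrDr scalerDl.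
Qed.

Lemma pa_mulZl k (f g : path_alg) : k *: pa_mul f g = pa_mul (k *: f) g.
Proof.
rewrite (@pa_mulEw (k *: f) g (msupp f) (msupp g)) ?pa_suppZ_le //.
rewrite pa_mul.unlock.
rewrite scaler_sumr; apply: eq_bigr => p _; rewrite scaler_sumr.
by apply: eq_bigr => q _; rewrite scalerA pa_coefZ mulrA.
Qed.

Lemma pa_mulZr k (f g : path_alg) : k *: pa_mul f g = pa_mul f (k *: g).
Proof.
rewrite (@pa_mulEw f (k *: g) (msupp f) (msupp g)) ?pa_suppZ_le //.
rewrite pa_mul.unlock.
rewrite scaler_sumr; apply: eq_bigr => p _; rewrite scaler_sumr.
by apply: eq_bigr => q _; rewrite scalerA pa_coefZ mulrCA.
Qed.

Lemma pa_mul0l f : pa_mul 0 f = 0.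
Proof. by have := pa_mulZl 0 0 f; rewrite !scale0r. Qed.
Lemma pa_mul0r f : pa_mul f 0 = 0.
Proof. by have := pa_mulZr 0 f 0; rewrite !scale0r. Qed.

Lemma pa_mul_suml (I : Type) (r : seq I) (P : pred I) (F : I -> path_alg) g :
  pa_mul (\sum_(i <- r | P i) F i) g = \sum_(i <- r | P i) pa_mul (F i) g.
Proof.
exact: (big_morph (pa_mul^~ g) (fun x y => pa_mulDl x y g) (pa_mul0l g)).
Qed.
Lemma pa_mul_sumr (I : Type) (r : seq I) (P : pred I) (F : I -> path_alg) g :
  pa_mul g (\sum_(i <- r | P i) F i) = \sum_(i <- r | P i) pa_mul g (F i).
Proof.
exact: (big_morph (pa_mul g) (pa_mulDr g) (pa_mul0r g)).
Qed.

Lemma pa_mulEpath p q : pa_mul (path_elt p) (path_elt q) = path_mul p q.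
Proof.
rewrite (@pa_mulEw _ _ [fset p]%fset [fset q]%fset);
  try by rewrite path_elt.unlock msuppU_le.
by rewrite !big_seq_fset1 path_elt.unlock !mcoeffUU mulr1 scale1r.
Qed.

Lemma path_elt_coef p q : (path_elt p)@_q = (p == q)%:R.
Proof. by rewrite path_elt.unlock; exact: mcoeffU. Qed.

Lemma path_algE (f : path_alg) : f = \sum_(p <- msupp f) f@_p *: path_elt p.
Proof.
rewrite {1}(monalgE f); apply: eq_bigr => p _; apply/malgP => q.
by rewrite pa_coefZ path_elt_coef mcoeffU mulr_natr.
Qed.

Lemma path_alg_ind (P : path_alg -> Prop) :
  P 0 -> (forall f g, P f -> P g -> P (f + g)) ->
  (forall k f, P f -> P (k *: f)) -> (forall p, P (path_elt p)) ->
  forall f, P f.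
Proof.
move=> P0 PD PZ PE f; rewrite (path_algE f).
by elim/big_ind: _ => // p _; apply: PZ.
Qed.

Fact pa_mulA : associative pa_mul.
Proof.
move=> f g h; elim/path_alg_ind: f => [|f f' IH IH'|k f IH|p].
- by rewrite !pa_mul0l.
- by rewrite pa_mulDl IH IH' (pa_mulDl f) pa_mulDl.
- by rewrite -pa_mulZl IH -(pa_mulZl k f) -pa_mulZl.
elim/path_alg_ind: g => [|g g' IH IH'|k g IH|q].
- by rewrite pa_mul0l pa_mul0r pa_mul0l.
- by rewrite pa_mulDl pa_mulDr IH IH' (pa_mulDr _ g) pa_mulDl.
- by rewrite -(pa_mulZl k g) -pa_mulZr IH -(pa_mulZr k _ g) -pa_mulZl.
elim/path_alg_ind: h => [|h h' IH IH'|k h IH|r].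
- by rewrite !pa_mul0r.
- by rewrite (pa_mulDr _ h) pa_mulDr IH IH' pa_mulDr.
- by rewrite -(pa_mulZr k _ h) -pa_mulZr IH -pa_mulZr.
rewrite !pa_mulEpath; have := pcat_assoc p q r; rewrite /path_mul.
case: (pcat p q) (pcat q r) => [pq|] [qr|] /= e;
  by rewrite ?pa_mulEpath ?pa_mul0l ?pa_mul0r // /path_mul -?e // e.
Qed.

Fact pa_mul1l : left_id pa_one pa_mul.
Proof.
elim/path_alg_ind=> [|f g IHf IHg|k f IH|p]; first exact: pa_mul0r.
- by rewrite pa_mulDr IHf IHg.
- by rewrite -pa_mulZr IH.
rewrite /pa_one pa_mul_suml (bigD1 (pstart p)) //= pa_mulEpath /path_mul.
have [|r -> vr] := @pcatT Q (triv_path (pstart p)) p => //.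
rewrite big1 => [|v vp]; last first.
  by rewrite pa_mulEpath /path_mul pcatF //; apply/eqP.
have -> : r = p by apply: val_inj; rewrite vr /= /pstart; case: (qpval p).
exact: addr0.
Qed.

Fact pa_mul1r : right_id pa_one pa_mul.
Proof.
elim/path_alg_ind=> [|f g IHf IHg|k f IH|p]; first exact: pa_mul0l.
- by rewrite pa_mulDl IHf IHg.
- by rewrite -pa_mulZl IH.
rewrite /pa_one pa_mul_sumr (bigD1 (pend p)) //= pa_mulEpath /path_mul.
have [|r -> vr] := @pcatT Q p (triv_path (pend p)) => //.
rewrite big1 => [|v vp]; last first.
  by rewrite pa_mulEpath /path_mul pcatF //; apply/eqP; rewrite eq_sym.
have -> : r = p by apply: val_inj; rewrite vr /= cats0; case: (qpval p).
exact: addr0.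
Qed.

Lemma pa_one_coef v : pa_one@_(triv_path v) = 1.
Proof.
rewrite /pa_one raddf_sum (bigD1 v) //= path_elt_coef eqxx big1 ?addr0 //.
move=> w wv; rewrite path_elt_coef; case: eqP => // /(congr1 val) [wv'].
by rewrite wv' eqxx in wv.
Qed.

Fact pa_one_neq0 : pa_one != 0.
Proof.
have /card_gt0P[v _] := qvert_gt0 Q.
apply/eqP=> /(congr1 (mcoeff (triv_path v))) /eqP.
by rewrite pa_one_coef mcoeff0 oner_eq0.
Qed.

Lemma pa_mul_coef (f g : path_alg) v :
  (pa_mul f g)@_(triv_path v) = f@_(triv_path v) * g@_(triv_path v).
Proof.
elim/path_alg_ind: f => [|f f' IH IH'|k f IH|p].
- by rewrite pa_mul0l mcoeff0 mul0r.
- by rewrite pa_mulDl !mcoeffD IH IH' mulrDl.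
- by rewrite -pa_mulZl !pa_coefZ IH mulrA.
elim/path_alg_ind: g => [|g g' IH IH'|k g IH|q].
- by rewrite pa_mul0r mcoeff0 mulr0.
- by rewrite pa_mulDr !mcoeffD IH IH' mulrDr.
- by rewrite -pa_mulZr !pa_coefZ IH mulrCA.
rewrite pa_mulEpath /path_mul !path_elt_coef -natrM mulnb.
have [pq|pq] := eqVneq (pend p) (pstart q); last first.
  rewrite pcatF ?mcoeff0; last exact/eqP.
  have [ep|//] := eqVneq p (triv_path v); have [eq|//] := eqVneq q (triv_path v).
  by rewrite ep eq eqxx in pq.
have [r -> vr] := pcatT pq; rewrite path_elt_coef; congr (_%:R); congr nat_of_bool.
rewrite -!val_eqE vr; move: pq; rewrite /pend /pstart /=.
case: (qpval p) (qpval q) => [a s] [b t] /= pq.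
rewrite !xpair_eqE; case: s pq => [|c s] /= pq; last by rewrite !andbF.
by rewrite pq andbT; case: (_ == _).
Qed.

HB.instance Definition _ := GRing.Zmodule_isNzRing.Build path_alg
  pa_mulA pa_mul1l pa_mul1r pa_mulDl pa_mulDr pa_one_neq0.
HB.instance Definition _ := GRing.Lmodule_isLalgebra.Build K path_alg pa_mulZl.
HB.instance Definition _ := GRing.Lalgebra_isAlgebra.Build K path_alg pa_mulZr.

Definition arr (a : qarrow Q) : path_alg := path_elt (arrow_path a).

Definition arrow_ideal : set path_alg := ideal_gen (range arr).

Definition admissible (I : set path_alg) : Prop :=
  (exists2 n, (2 <= n)%N & ideal_exp arrow_ideal n `<=` I) /\
  I `<=` ideal_exp arrow_ideal 2.

Definition multiserial_cond (I : set path_alg) : Prop :=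
  forall a : qarrow Q,
    (forall b b', ~ I (arr a * arr b) -> ~ I (arr a * arr b') -> b = b') /\
    (forall c c', ~ I (arr c * arr a) -> ~ I (arr c' * arr a) -> c = c').

Definition no_vertex_part : set path_alg :=
  [set f | forall v, f@_(triv_path v) = 0].

Lemma no_vertex_part_ideal : is_ideal no_vertex_part.
Proof.
split; first split.
- by move=> v; rewrite mcoeff0.
- by move=> f g f0 g0 v; rewrite mcoeffD f0 g0 addr0.
- by move=> f g g0 v; rewrite [LHS]pa_mul_coef g0 mulr0.
- by move=> f g g0 v; rewrite [LHS]pa_mul_coef g0 mul0r.
Qed.

Lemma no_vertex_part_arr a : no_vertex_part (arr a).
Proof. by move=> v; rewrite path_elt_coef -val_eqE /= xpair_eqE andbF. Qed.

Lemma no_vertex_part1 : ~ no_vertex_part 1.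
Proof.
have /card_gt0P[v _] := qvert_gt0 Q.
by move=> /(_ v) /eqP; rewrite [X in X == _]pa_one_coef oner_eq0.
Qed.

End PathAlgebra.

Section Morita.
Variable K : pzRingType.

(* A K-linear functor from A-modules to B-modules; K acts on an A-module
   through [k%:A].  Composition and linearity are stated pointwise. *)
Record mod_functor (A B : algType K) := ModFunctor {
  fobj :> lmodType A -> lmodType B;
  fmap : forall M N : lmodType A,
    {linear M -> N} -> {linear fobj M -> fobj N};
  fmap_id : forall (M : lmodType A) (f : {linear M -> M}),
    f =1 id -> fmap f =1 id;
  fmap_comp : forall (M N P : lmodType A) (f : {linear M -> N})
      (g : {linear N -> P}) (h : {linear M -> P}),
    h =1 g \o f -> fmap h =1 fmap g \o fmap f;
  fmap_linear : forall (M N : lmodType A) (k : K) (f g h : {linear M -> N}),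
    (forall x, h x = k%:A *: f x + g x) ->
    forall y, fmap h y = k%:A *: fmap f y + fmap g y }.

Definition morita_equivalent (A B : algType K) : Prop :=
  exists (F : mod_functor A B) (G : mod_functor B A)
         (eta : forall M : lmodType A, {linear M -> G (F M)})
         (eps : forall N : lmodType B, {linear F (G N) -> N}),
    [/\ forall M, bijective (eta M),
        forall N, bijective (eps N),
        forall (M M' : lmodType A) (f : {linear M -> M'}),
          eta M' \o f =1 fmap G (fmap F f) \o eta M &
        forall (N N' : lmodType B) (g : {linear N -> N'}),
          eps N' \o fmap F (fmap G g) =1 g \o eps N].

End Morita.

Definition symmetric_alg (K : pzRingType) (A : algType K) : Prop :=
  exists f : {scalar A},
    (forall x y, f (x * y) = f (y * x)) /\
    forall J : set A, is_ideal J -> (forall x, J x -> f x = 0) ->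
      J `<=` [set 0].

Definition special_multiserial (K : fieldType) (A : algType K) : Prop :=
  exists (Q : quiver) (I : two_sided_ideal (path_alg K Q)),
    [/\ admissible I, multiserial_cond I &
        morita_equivalent A (quot_alg I)].

Record brauer_data := BrauerData {
  bvert : finType;
  bpoly : finType;
  (* distinct indices may carry the same multiset *)
  polygon : bpoly -> {mset bvert}%mset;
  bmult : bvert -> nat }.

Section BrauerData.
Variable G : brauer_data.

Definition bval (x : bvert G) : nat := (\sum_(V : bpoly G) polygon V x)%N.

Definition truncated (x : bvert G) : bool := (bval x * bmult x == 1)%N.

End BrauerData.

(* [orient x] lists the polygons at [x] in the cyclic order, starting from an
   arbitrary one; when [x] is truncated there is only one such list, so that
   asking for it is no choice.  [bpoly_gt0] excludes the empty configuration,
   whose algebra would be zero. *)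
Record brauer_config := BrauerConfig {
  bdata :> brauer_data;
  orient : forall x : bvert bdata, (bval x).-tuple (bpoly bdata);
  bmult_gt0 : forall x : bvert bdata, (0 < bmult x)%N;
  orient_count : forall (x : bvert bdata) (V : bpoly bdata),
    count_mem V (orient x) = polygon V x;
  bpoly_gt0 : (0 < #|bpoly bdata|)%N;
  bvert_in_polygon : forall x : bvert bdata,
    exists V : bpoly bdata, x \in polygon V;
  polygon_size : forall V : bpoly bdata, (2 <= size (polygon V))%N;
  polygon_nontruncated : forall V : bpoly bdata,
    exists2 x, x \in polygon V & (1 < bval x * bmult x)%N;
  polygon_truncated : forall (x : bvert bdata) (V : bpoly bdata),
    truncated x -> x \in polygon V -> size (polygon V) = 2%N }.

Section BrauerAlgebra.
Variables (K : fieldType) (G : brauer_config).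

(* the arrow indexed by [(x, i)] joins the i-th polygon at [x] to its
   successor *)
Definition brauer_arrow : finType :=
  {u : {x : bvert G & 'I_(bval x)} | ~~ truncated (tag u)}.

Definition barrow_src (a : brauer_arrow) : bpoly G :=
  tnth (orient (tag (val a))) (tagged (val a)).

Definition barrow_tgt (a : brauer_arrow) : bpoly G :=
  tnth (orient (tag (val a))) (ordS (tagged (val a))).

Definition brauer_quiver : quiver :=
  Quiver barrow_src barrow_tgt (bpoly_gt0 G).

Definition barrow (x : bvert G) (nx : ~~ truncated x) (i : 'I_(bval x)) :
    qarrow brauer_quiver :=
  exist (fun u : {x : bvert G & 'I_(bval x)} => ~~ truncated (tag u))
    (Tagged (fun x => 'I_(bval x)) i) nx.

(* the arrows of the special x-cycle that starts at the i-th polygon at [x] *)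
Definition special_cycle (x : bvert G) (nx : ~~ truncated x)
    (i : 'I_(bval x)) : seq (qarrow brauer_quiver) :=
  [seq barrow nx j | j <- traject (@ordS (bval x)) i (bval x)].

Definition cycle_elt (x : bvert G) (nx : ~~ truncated x) (i : 'I_(bval x)) :
    path_alg K brauer_quiver :=
  \prod_(a <- special_cycle nx i) arr K a.

Inductive brauer_relation : set (path_alg K brauer_quiver) :=
| BrauerRel1 (x y : bvert G) (nx : ~~ truncated x) (ny : ~~ truncated y)
    (i : 'I_(bval x)) (j : 'I_(bval y)) :
    tnth (orient x) i = tnth (orient y) j ->
    brauer_relation (cycle_elt nx i ^+ bmult x - cycle_elt ny j ^+ bmult y)
| BrauerRel2 (x : bvert G) (nx : ~~ truncated x) (i : 'I_(bval x)) :
    brauer_relation (cycle_elt nx i ^+ bmult x * arr K (barrow nx i))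
| BrauerRel3 (a b : qarrow brauer_quiver) :
    tgt a = src b ->
    (forall x (nx : ~~ truncated x) (i : 'I_(bval x)),
       ~~ infix [:: a; b] (special_cycle nx i)) ->
    ~ (a = b /\ bval (tag (val a)) = 1%N /\ (1 < bmult (tag (val a)))%N) ->
    brauer_relation (arr K a * arr K b).

Lemma cycle_elt_no_vertex_part (x : bvert G) (nx : ~~ truncated x)
    (i : 'I_(bval x)) :
  no_vertex_part (cycle_elt nx i ^+ bmult x).
Proof.
have [_ Mr] := @no_vertex_part_ideal K brauer_quiver.
have x_gt0 : (0 < bval x)%N := leq_trans (ltn0Sn i) (ltn_ord i).
have trajS n : (0 < n)%N -> exists t, traject (@ordS (bval x)) i n = i :: t.
  by case: n => // n _; eexists.
have n0 : no_vertex_part (cycle_elt nx i).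
  rewrite /cycle_elt /special_cycle; have [t ->] := trajS _ x_gt0.
  by rewrite big_cons; apply: Mr; exact: no_vertex_part_arr.
have m_gt0 := bmult_gt0 x.
by rewrite -(prednK m_gt0) exprS; exact: Mr.
Qed.

Fact brauer_relation_proper : ~ ideal_gen brauer_relation 1.
Proof.
have idP := @no_vertex_part_ideal K brauer_quiver.
have [[P0 PD PMl] PMr] := idP.
suff sub : brauer_relation `<=` @no_vertex_part K brauer_quiver.
  by move=> /(smallest_sub idP sub); exact: no_vertex_part1.
move=> f [x y nx ny i j _|x nx i|a b _ _ _].
- apply: PD; first exact: cycle_elt_no_vertex_part.
  by rewrite -mulN1r; apply: PMl; exact: cycle_elt_no_vertex_part.
- by apply: PMl; exact: no_vertex_part_arr.
- by apply: PMl; exact: no_vertex_part_arr.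
Qed.

Definition brauer_ideal : two_sided_ideal (path_alg K brauer_quiver) :=
  TwoSidedIdeal (ideal_genP brauer_relation) brauer_relation_proper.

Definition brauer_alg : algType K := quot_alg brauer_ideal.

End BrauerAlgebra.

(* Main.v *)
From HB Require Import structures.
From mathcomp Require Import finmap multiset monalg.
Require Import Defs.
From mathcomp Require Import all_boot all_algebra all_classical.

(** Let A be the given algebra. Both directions rest on one symmetric form on path
    algebras.

    Suppose that the arrows of a quiver are permuted by a map [nxt] compatible
    with sources and targets, and that a length [len], constant on the cycles of
    this permutation and a multiple of their sizes, is given. The cycle form takes
    the value one on the runs a, nxt a, ... of length [len a] and zero on all other
    paths. It is symmetric, because a rotation of such a run is again one. For an
    ideal J containing the three types of Brauer relations, trivial paths,
    shorter runs and full runs span the path algebra modulo J, and the form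
    exhibits explicit dual bases; hence the radical of the form lies in J
    ([form_rad_sub]). If in addition J contains no full run, then J lies in
    the radical: an element outside it has a multiple that is a nontrivial
    combination of full runs modulo J ([sub_form_rad]). So there is exactly one
    such ideal.

    For a Brauer configuration the ideal of relations is therefore the radical of
    the cycle form ([brauer_idealE]), the algebra is symmetric, and admissibility
    and the multiserial condition are read off the relations.

    Conversely let A be symmetric and Morita equivalent to an admissible quotient B
    satisfying the multiserial condition. Both algebras are basic, hence
    isomorphic ([morita_basic_iso]). In B every arrow has exactly one continuation
    with nonzero product: an arrow without continuation lies in the socle, and a
    one-dimensional socle at its vertex forces this vertex to split off, which
    indecomposability and the nonzero square of the radical exclude. The longest
    nonzero path from an arrow a lies in the socle, so the form of B does not vanish
    on it, nor on its rotations; hence the path closes up at a and is a power of a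
    cycle ([symmetric_cycle_structure]). Since the field is algebraically closed,
    one arrow on each cycle can be rescaled so that the form is one on all these
    paths ([cycle_normalization]); then those at the same vertex coincide. The
    cycles, together with truncated vertices where only one arrow starts, make up
    a Brauer configuration ([orbit_config]) with the same quiver, and the morphism
    from its path algebra to B has a kernel of the kind considered above, so it is
    the ideal of relations ([brauer_presentation]). *)

Set Implicit Arguments.
Unset Strict Implicit.
Unset Printing Implicit Defensive.

Import GRing.Theory.

Local Open Scope classical_set_scope.
Local Open Scope ring_scope.

(** * Ideals, isomorphisms and quotients of algebras *)

Definition mk_linear (R : pzRingType) (U V : lmodType R) (f : U -> V)
    (fL : linear f) : {linear U -> V} :=
  HB.pack f (GRing.isLinear.Build R U V *:%R f fL).

Definition mk_scalar (K : pzRingType) (U : lmodType K) (f : U -> K)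
    (fL : scalar f) : {scalar U} :=
  HB.pack f (GRing.isLinear.Build K U K *%R f fL).

Definition mk_lrmorphism (K : pzRingType) (A B : algType K) (f : A -> B)
    (fL : linear f) (fM : multiplicative f) : {lrmorphism A -> B} :=
  HB.pack f (GRing.isLinear.Build K A B *:%R f fL)
            (GRing.isMultiplicative.Build A B f fM).

Section Ideals.
Variables (R : pzRingType) (J : set R).
Hypothesis JP : is_ideal J.

Lemma ideal_zero : J 0. Proof. by case: JP => -[]. Qed.
Lemma ideal_add x y : J x -> J y -> J (x + y).
Proof. by case: JP => -[_ D _] _; exact: D. Qed.
Lemma ideal_mull a x : J x -> J (a * x).
Proof. by case: JP => -[_ _ M] _; exact: M. Qed.
Lemma ideal_mulr a x : J x -> J (x * a).
Proof. by case: JP => _ M; exact: M. Qed.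
Lemma ideal_opp x : J x -> J (- x).
Proof. by rewrite -mulN1r; exact: ideal_mull. Qed.
Lemma ideal_sub x y : J x -> J y -> J (x - y).
Proof. by move=> Jx /ideal_opp; exact: ideal_add. Qed.
Lemma ideal_sum I (r : seq I) (P : pred I) F :
  (forall i, P i -> J (F i)) -> J (\sum_(i <- r | P i) F i).
Proof. by move=> JF; elim/big_ind: _ => //; [exact: ideal_zero | exact: ideal_add]. Qed.

End Ideals.

Lemma ideal_scale (K : pzRingType) (A : algType K) (J : set A) k x :
  is_ideal J -> J x -> J (k *: x).
Proof. by move=> JP Jx; rewrite -(mul1r x) scalerAl; exact: ideal_mull. Qed.

Section AlgIso.
Variable K : pzRingType.

Lemma alg_isoP (A B : algType K) : alg_iso A B ->
  exists (f : {lrmorphism A -> B}) (g : {lrmorphism B -> A}),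
    cancel f g /\ cancel g f.
Proof.
case=> f [g fK gK].
have gL : linear g by move=> k x y; apply: (can_inj fK); rewrite linearP /= !gK.
have gM : multiplicative g.
  by split=> [x y|]; apply: (can_inj fK); rewrite ?rmorphM ?rmorph1 /= !gK.
by exists f, (mk_lrmorphism gL gM).
Qed.

Lemma alg_iso_sym (A B : algType K) : alg_iso A B -> alg_iso B A.
Proof. by move=> /alg_isoP[f [g [fK gK]]]; exists g; exists f. Qed.

Lemma alg_iso_trans (A B C : algType K) :
  alg_iso A B -> alg_iso B C -> alg_iso A C.
Proof. by case=> f fB [g gB]; exists (g \o f); exact: bij_comp. Qed.

Lemma indecomposable_iso (A B : algType K) :
  alg_iso A B -> indecomposable A -> indecomposable B.
Proof. by move=> AB iA C D BCD; exact: (iA C D (alg_iso_trans AB BCD)). Qed.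

Lemma symmetric_iso (A B : algType K) :
  alg_iso A B -> symmetric_alg A -> symmetric_alg B.
Proof.
move=> /alg_isoP[h [g [hK gK]]] [f [fC fJ]].
have fgL : scalar (f \o g) by move=> k x y /=; rewrite !linearP.
exists (mk_scalar fgL); split=> [x y|J JP J0 x Jx] /=.
  by rewrite !rmorphM fC.
apply: (can_inj gK); rewrite [RHS]rmorph0.
apply: (fJ [set a | J (h a)]) => /=; last 2 first.
- by move=> a Ja; rewrite -(hK a); exact: (J0 _ Ja).
- by rewrite gK.
split; first split=> /=.
- by rewrite rmorph0; exact: ideal_zero.
- by move=> a b; rewrite /= rmorphD; exact: ideal_add.
- by move=> a b; rewrite /= rmorphM; exact: ideal_mull.
- by move=> a b; rewrite /= rmorphM; exact: ideal_mulr.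
Qed.

End AlgIso.

Section QuotientMorphism.
Variables (K : pzRingType) (A : algType K) (I : two_sided_ideal A).

Fact qproj_linear : linear (qproj I).
Proof. by move=> k x y; rewrite qprojD qprojZ. Qed.
Fact qproj_multiplicative : multiplicative (qproj I).
Proof. by split=> [x y|//]; exact: qprojM. Qed.

(** The projection is locked: simplification must not expose the quotient
    construction, so that the morphism lemmas keep applying to it. *)
Fact qpr_key : unit. Proof. exact: tt. Qed.
Definition qpr : {lrmorphism A -> quot_alg I} :=
  locked_with qpr_key (mk_lrmorphism qproj_linear qproj_multiplicative).

Lemma qprE x : qpr x = qproj I x.
Proof. by rewrite /qpr unlock. Qed.

Lemma qpr_eq0 x : qpr x = 0 <-> ideal_set I x.
Proof. by have := qproj_eq I x 0; rewrite subr0 -!qprE rmorph0. Qed.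

Lemma qreprE x : qpr (qrepr x) = x.
Proof. by rewrite qprE qreprK. Qed.

End QuotientMorphism.

Lemma quot_iso (K : pzRingType) (A B : algType K) (I : two_sided_ideal A)
    (p : {lrmorphism A -> B}) :
  (forall x, ideal_set I x <-> p x = 0) -> (forall b, exists x, p x = b) ->
  alg_iso (quot_alg I) B.
Proof.
move=> Ip pS; pose f (x : quot_alg I) : B := p (qrepr x).
have fq x : f (qpr I x) = p x.
  apply/eqP; rewrite -subr_eq0 -rmorphB -oppr_eq0 -rmorphN opprB; apply/eqP/Ip.
  by rewrite qprE; exact: qreprP.
have fL : linear f.
  by move=> k x y; rewrite -(qreprE x) -(qreprE y) -(linearP (qpr I)) !fq linearP.
have fM : multiplicative f.
  split=> [x y|]; last by rewrite -(rmorph1 (qpr I)) fq rmorph1.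
  by rewrite -(qreprE x) -(qreprE y) -(rmorphM (qpr I)) !fq rmorphM.
exists (mk_lrmorphism fL fM).
have fI x y : f x = f y -> x = y.
  move=> fxy; rewrite -(qreprE x) -(qreprE y); apply/eqP; rewrite -subr_eq0 -rmorphB.
  by apply/eqP/qpr_eq0/Ip; rewrite rmorphB; apply/eqP; rewrite subr_eq0; apply/eqP.
have gP b : {y | f y = b}.
  by apply: cid; have [x <-] := pS b; exists (qpr I x); rewrite fq.
by exists (fun b => sval (gP b)) => [x|b] /=; [apply: fI; case: gP | case: gP].
Qed.

(** * Path algebras *)

Section PathElements.
Variables (K : fieldType) (Q : quiver).
Local Notation PA := (path_alg K Q).
Local Notation path_elt := (@path_elt K Q).
Local Notation arr := (@arr K Q).
Implicit Types (a b : qarrow Q) (s t : seq (qarrow Q)) (v : qvert Q) (p : qpath Q).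

Definition idem v : PA := path_elt (triv_path v).
Definition walk_end v s : qvert Q := last v [seq tgt a | a <- s].
Definition word s : PA := \prod_(a <- s) arr a.

Lemma path_eltM p q : path_elt p * path_elt q = path_mul K p q.
Proof. exact: pa_mulEpath. Qed.

Lemma path_eltM_cat p q : pend p = pstart q ->
  exists2 r, path_elt p * path_elt q = path_elt r & val r = (p.1, p.2 ++ q.2).
Proof.
by move=> /pcatT[r pq vr]; exists r => //; rewrite path_eltM /path_mul pq.
Qed.

Lemma path_eltM0 p q : pend p != pstart q -> path_elt p * path_elt q = 0.
Proof. by move=> /eqP pq; rewrite path_eltM /path_mul pcatF. Qed.

Lemma idem_sum : \sum_v idem v = 1.
Proof. by []. Qed.

Lemma idem_path v p : idem v * path_elt p = (v == pstart p)%:R *: path_elt p.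
Proof.
have [vp|vp] := eqVneq v (pstart p); last first.
  by rewrite scale0r; exact: path_eltM0.
have [//|r -> vr] := @path_eltM_cat (triv_path v) p.
rewrite scale1r; congr path_elt; apply: val_inj.
by rewrite vr vp /pstart /=; case: (qpval p).
Qed.

Lemma path_idem v p : path_elt p * idem v = (pend p == v)%:R *: path_elt p.
Proof.
have [vp|vp] := eqVneq (pend p) v; last first.
  by rewrite scale0r; exact: path_eltM0.
have [//|r -> vr] := @path_eltM_cat p (triv_path v).
rewrite scale1r; congr path_elt; apply: val_inj.
by rewrite vr cats0 /=; case: (qpval p).
Qed.

Lemma idemM v w : idem v * idem w = (v == w)%:R *: idem v.
Proof. by rewrite path_idem. Qed.

Lemma idem_arr v a : idem v * arr a = (v == src a)%:R *: arr a.
Proof. exact: idem_path. Qed.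

Lemma arr_idem v a : arr a * idem v = (tgt a == v)%:R *: arr a.
Proof. exact: path_idem. Qed.

Lemma arrM0 a b : tgt a != src b -> arr a * arr b = 0.
Proof. exact: (@path_eltM0 (arrow_path a) (arrow_path b)). Qed.

Lemma path_eltE p : path_elt p = idem p.1 * word p.2.
Proof.
case: p => -[v s] w /=; rewrite /word.
elim: s v w => [|a s IHs] v w; first by rewrite big_nil mulr1; congr path_elt; apply: val_inj.
have /andP[/eqP av ws] : (src a == v) && walk (tgt a) s := w.
subst v.
rewrite big_cons mulrA idem_arr eqxx scale1r.
have := @path_eltM_cat (arrow_path a) (QPath (qpval := (tgt a, s)) ws) erefl.
case=> r + vr; rewrite IHs mulrA arr_idem eqxx scale1r => ->.
by congr path_elt; apply: val_inj; rewrite vr.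
Qed.

Lemma word_path a s (w : walk (src a) (a :: s)) :
  word (a :: s) = path_elt (QPath (qpval := (src a, a :: s)) w).
Proof. by rewrite path_eltE /= /word big_cons mulrA idem_arr eqxx scale1r. Qed.

Lemma word_cat s t : word (s ++ t) = word s * word t.
Proof. by rewrite /word big_cat. Qed.

Lemma word_cons a s : word (a :: s) = arr a * word s.
Proof. by rewrite /word big_cons. Qed.

Lemma word_not_walk a s : ~~ walk (src a) (a :: s) -> word (a :: s) = 0.
Proof.
elim: s a => [|b s IHs] a /=; first by rewrite eqxx.
rewrite eqxx /= word_cons; have [_ /= w|ab _] := eqVneq (src b) (tgt a).
  by rewrite IHs ?mulr0 //= eqxx.
by rewrite word_cons mulrA arrM0 ?mul0r // eq_sym.
Qed.

End PathElements.

Section PathExtension.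
Variables (K : fieldType) (Q : quiver) (V : lmodType K) (g : qpath Q -> V).

Definition pa_ext_fun (x : path_alg K Q) : V :=
  \sum_(p <- msupp x) x@_p *: g p.

Lemma pa_extEw x (d : {fset qpath Q}) : (msupp x `<=` d)%fset ->
  pa_ext_fun x = \sum_(p <- d) x@_p *: g p.
Proof.
move=> sx; apply: (big_fset_incl _ sx) => p _ /mcoeff_outdom ->.
by rewrite scale0r.
Qed.

Fact pa_ext_linear : linear pa_ext_fun.
Proof.
move=> k x y; set d := (msupp x `|` msupp y)%fset.
have skx : (msupp (k *: x) `<=` d)%fset.
  exact: fsubset_trans (pa_suppZ_le k x) (fsubsetUl _ _).
have sxy : (msupp (k *: x + y) `<=` d)%fset.
  apply: fsubset_trans (msuppD_le _ _) _.
  by rewrite fsubUset skx fsubsetUr.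
rewrite (pa_extEw sxy) (@pa_extEw x d) ?fsubsetUl // (@pa_extEw y d) ?fsubsetUr //.
rewrite scaler_sumr -big_split; apply: eq_bigr => p _ /=.
by rewrite mcoeffD pa_coefZ scalerDl scalerA.
Qed.

Definition pa_ext : {linear path_alg K Q -> V} := mk_linear pa_ext_linear.

Lemma pa_ext_path p : pa_ext (path_elt K p) = g p.
Proof.
rewrite /= (@pa_extEw _ [fset p]%fset); last by rewrite path_elt.unlock msuppU_le.
by rewrite big_seq_fset1 path_elt_coef eqxx scale1r.
Qed.

End PathExtension.

Lemma linear_path_multiplicative (K : fieldType) (Q : quiver) (B : algType K)
    (g : {linear path_alg K Q -> B}) :
  g 1 = 1 ->
  (forall p q, g (path_elt K p * path_elt K q) = g (path_elt K p) * g (path_elt K q)) ->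
  multiplicative g.
Proof.
move=> g1 gM; split=> // y z.
elim/path_alg_ind: y => [|y y' IH IH'|k y IH|p].
- by rewrite mul0r !linear0 mul0r.
- by rewrite mulrDl !linearD mulrDl IH IH'.
- by rewrite -scalerAl !linearZ /= IH scalerAl.
elim/path_alg_ind: z => [|z z' IH IH'|k z IH|q //].
- by rewrite mulr0 !linear0 mulr0.
- by rewrite mulrDr !linearD mulrDr IH IH'.
- by rewrite -scalerAr !linearZ /= IH scalerAr.
Qed.

Section PathMorphism.
Variables (K : fieldType) (Q : quiver) (B : algType K).
Variables (e : qvert Q -> B) (x : qarrow Q -> B).
Hypothesis e_ortho : forall v w, e v * e w = (v == w)%:R *: e v.
Hypothesis e_sum : \sum_v e v = 1.
Hypothesis src_x : forall a, e (src a) * x a = x a.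
Hypothesis x_tgt : forall a, x a * e (tgt a) = x a.

Definition path_image (p : qpath Q) : B := e p.1 * \prod_(a <- p.2) x a.

(** The image of a path absorbs the idempotent of its end vertex; this is what
    makes the images of non-composable paths multiply to zero. *)
Lemma path_image_end (p : qpath Q) : path_image p * e (pend p) = path_image p.
Proof.
rewrite /path_image /pend; case: p => -[v s] /=; elim: s v => [|a s IHs] v /=.
  by rewrite big_nil mulr1 e_ortho eqxx scale1r.
case/andP=> /eqP <- /IHs; rewrite big_cons mulrA src_x -(x_tgt a) -!mulrA.
by move=> ->.
Qed.

Lemma path_image_cat (p q : qpath Q) :
  pa_ext path_image (path_mul K p q) = path_image p * path_image q.
Proof.
have [pq|pq] := eqVneq (pend p) (pstart q); last first.
  rewrite /path_mul pcatF; last exact/eqP.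
  rewrite linear0 -path_image_end -mulrA [path_image q]/path_image.
  rewrite (mulrA (e (pend p))) e_ortho -[q.1]/(pstart q) (negbTE pq).
  by rewrite scale0r mul0r mulr0.
rewrite /path_mul; have [r -> vr] := pcatT pq.
have pE := path_image_end p; rewrite pq in pE.
rewrite pa_ext_path [path_image q]/path_image (mulrA (path_image p)) [_ * e _]pE.
by rewrite /path_image vr /= big_cat /= mulrA.
Qed.

Fact path_morphism_multiplicative : multiplicative (pa_ext path_image).
Proof.
apply: linear_path_multiplicative => [|p q]; last first.
  by rewrite path_eltM path_image_cat !pa_ext_path.
rewrite -(idem_sum K Q) linear_sum -e_sum; apply: eq_bigr => v _.
by rewrite pa_ext_path /path_image big_nil mulr1.
Qed.

Fact path_morphism_key : unit. Proof. exact: tt. Qed.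
(** The universal property of the path algebra: orthogonal idempotents that sum
    to one, with elements placed between them, are the images of the vertices
    and arrows under one algebra morphism. *)
Definition path_morphism : {lrmorphism path_alg K Q -> B} :=
  locked_with path_morphism_key
    (mk_lrmorphism (pa_ext_linear path_image) path_morphism_multiplicative).

Lemma path_morphism_path p : path_morphism (path_elt K p) = path_image p.
Proof. by rewrite /path_morphism unlock; exact: pa_ext_path. Qed.

Lemma path_morphism_idem v : path_morphism (idem K v) = e v.
Proof. by rewrite path_morphism_path /path_image big_nil mulr1. Qed.

Lemma path_morphism_arr a : path_morphism (arr K a) = x a.
Proof. by rewrite path_morphism_path /path_image big_seq1 src_x. Qed.

Lemma path_morphism_word s : path_morphism (word K s) = \prod_(a <- s) x a.
Proof.
rewrite /word rmorph_prod; apply: eq_bigr => a _; exact: path_morphism_arr.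
Qed.

End PathMorphism.

(** * Powers of the arrow ideal *)

Lemma sub_ideal_gen (R : pzRingType) (S : set R) : S `<=` ideal_gen S.
Proof. exact: sub_smallest. Qed.

Lemma ideal_gen_sub (R : pzRingType) (S J : set R) :
  is_ideal J -> S `<=` J -> ideal_gen S `<=` J.
Proof. by move=> JP SJ; exact: smallest_sub. Qed.

Lemma ideal_setT (R : pzRingType) : is_ideal (@setT R).
Proof. by []. Qed.

Lemma ideal_mul_ideal (R : pzRingType) (J1 J2 : set R) :
  is_ideal J1 -> is_ideal J2 -> is_ideal (ideal_mul J1 J2).
Proof.
move=> J1P J2P; split; first split.
- by exists [::]; rewrite big_nil.
- move=> x y [s [sJ ->]] [t [tJ ->]]; exists (s ++ t); rewrite big_cat.
  by split=> // u; rewrite mem_cat => /orP[/sJ|/tJ].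
- move=> a x [s [sJ ->]]; exists [seq (a * u.1, u.2) | u <- s].
  split; last by rewrite mulr_sumr big_map; apply: eq_bigr => u _; rewrite mulrA.
  by move=> _ /mapP[u /sJ[J1u J2u] ->]; split=> //; exact: ideal_mull.
- move=> a x [s [sJ ->]]; exists [seq (u.1, u.2 * a) | u <- s].
  split; last by rewrite mulr_suml big_map; apply: eq_bigr => u _; rewrite mulrA.
  by move=> _ /mapP[u /sJ[J1u J2u] ->]; split=> //; exact: ideal_mulr.
Qed.

Lemma ideal_exp_ideal (R : pzRingType) (J : set R) n :
  is_ideal J -> is_ideal (ideal_exp J n).
Proof.
by move=> JP; elim: n => [|n IHn]; [exact: ideal_setT | exact: ideal_mul_ideal].
Qed.

Section LongElements.
Variables (K : fieldType) (Q : quiver).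
Local Notation PA := (path_alg K Q).
Local Notation word := (@word K Q).

(** The filtration of the path algebra by path length; its n-th step turns out
    to be the n-th power of the arrow ideal. *)
Definition long n : set PA := [set x | forall p : qpath Q, (size p.2 < n)%N -> x@_p = 0].

Lemma long_path n (p : qpath Q) : (n <= size p.2)%N -> long n (path_elt K p).
Proof.
move=> le_n q lt_q; rewrite path_elt_coef; case: eqP => // pq.
by rewrite pq leqNgt lt_q in le_n.
Qed.

Lemma longM m n x y : long m x -> long n y -> long (m + n) (x * y).
Proof.
move=> xm yn r lt_r.
rewrite [x * y](@pa_mulEw K Q x y (msupp x) (msupp y)) // raddf_sum big1 // => p _.
rewrite raddf_sum big1 // => q _; rewrite [LHS]pa_coefZ.
have [lt_p|le_p] := ltnP (size p.2) m; first by rewrite xm // !mul0r.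
have [lt_q|le_q] := ltnP (size q.2) n; first by rewrite yn // mulr0 mul0r.
rewrite /path_mul; case E: (pcat p q) => [t|]; last by rewrite mcoeff0 mulr0.
have [pq|/eqP/pcatF] := eqVneq (pend p) (pstart q); last by rewrite E.
have [t' + vt] := pcatT pq; rewrite E => -[tt']; rewrite -{}tt' in vt.
rewrite path_elt_coef; case: eqP => [tr|]; last by rewrite mulr0.
by move: lt_r; rewrite -tr vt size_cat ltnNge leq_add.
Qed.

Lemma long_ideal n : is_ideal (long n).
Proof.
have long0 x : long 0 x by [].
split; first split.
- by move=> p _; rewrite mcoeff0.
- by move=> x y xn yn p np; rewrite mcoeffD xn // yn // addr0.
- by move=> a x xn; rewrite -(add0n n); exact: longM.
- by move=> a x xn; rewrite -(addn0 n); exact: longM.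
Qed.

Lemma long_sub n (J : set PA) : is_ideal J ->
  (forall p : qpath Q, (n <= size p.2)%N -> J (path_elt K p)) -> long n `<=` J.
Proof.
move=> JP Jp x xn; rewrite (path_algE x); apply: ideal_sum => // p _.
have [lt_p|le_p] := ltnP (size p.2) n.
  by rewrite xn // scale0r; exact: ideal_zero.
by apply: (@ideal_scale K PA) => //; exact: Jp.
Qed.

Lemma long_word s : long (size s) (word s).
Proof.
elim: s => [|a s IHs]; first by move=> p; rewrite ltn0.
by rewrite word_cons; apply: (@longM 1) => //; exact: long_path.
Qed.

Lemma word_arrow_exp n s : (n <= size s)%N -> ideal_exp (@arrow_ideal K Q) n (word s).
Proof.
elim: n s => // n IHn [//|a s] /= le_n; exists [:: (arr K a, word s)].
rewrite big_seq1 word_cons; split=> // u; rewrite inE => /eqP-> /=; split.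
  by apply: sub_ideal_gen; exists a.
exact: IHn.
Qed.

(** Powers of the arrow ideal are sums of products, which are hard to test for
    membership; reading coefficients instead decides it. *)
Lemma arrow_exp_long n : ideal_exp (@arrow_ideal K Q) n = long n.
Proof.
apply/seteqP; split.
  elim: n => // n IHn x [s [sJ ->]]; rewrite big_seq.
  apply: (ideal_sum (long_ideal _)) => u /sJ[u1 /IHn u2].
  apply: (@longM 1) => //; move: u1; apply: ideal_gen_sub; first exact: long_ideal.
  by move=> _ [a _ <-]; exact: long_path.
apply: long_sub; first by apply: ideal_exp_ideal; exact: ideal_genP.
move=> p np; rewrite path_eltE.
apply: ideal_mull; first by apply: ideal_exp_ideal; exact: ideal_genP.
exact: word_arrow_exp.
Qed.

End LongElements.

(** * The form of a quiver with cyclically arranged arrows *)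

Section CycleForm.
Variables (K : fieldType) (Q : quiver).
Variables (nxt : qarrow Q -> qarrow Q) (len : qarrow Q -> nat).
Hypothesis tgt_nxt : forall a, tgt a = src (nxt a).
Hypothesis len_nxt : forall a, len (nxt a) = len a.
Hypothesis iter_len : forall a, iter (len a) nxt a = a.
Hypothesis len_gt1 : forall a, (1 < len a)%N.

Local Notation PA := (path_alg K Q).
Local Notation word := (@word K Q).
Local Notation idem := (@idem K Q).
Local Notation run := (traject nxt).

Lemma len_gt0 a : (0 < len a)%N. Proof. exact: ltnW (len_gt1 a). Qed.

Lemma len_iter n a : len (iter n nxt a) = len a.
Proof. by elim: n => //= n; rewrite len_nxt. Qed.

Lemma nxt_inj : injective nxt.
Proof.
move=> a b ab; have lab : len a = len b by rewrite -len_nxt ab len_nxt.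
by rewrite -(iter_len a) -(iter_len b) -lab -(prednK (len_gt0 a)) !iterSr ab.
Qed.

Lemma iter_nxt_inj n : injective (iter n nxt).
Proof. by elim: n => //= n IHn a b /nxt_inj /IHn. Qed.

Lemma run_walk a n : walk (src a) (run a n).
Proof. by elim: n a => //= n IHn a; rewrite eqxx tgt_nxt IHn. Qed.

Lemma run_end a n : walk_end (src a) (run a n) = src (iter n nxt a).
Proof. by elim: n a => //= n IHn a; rewrite -iterS iterSr -IHn /= -tgt_nxt. Qed.

(** The default value of [insubd] is irrelevant: a run is a walk. *)
Lemma word_run a n : (0 < n)%N ->
  word (run a n) = path_elt K (insubd (triv_path (src a)) (src a, run a n)).
Proof.
case: n => // n _; rewrite [RHS]path_eltE val_insubd run_walk /=.
by rewrite word_cons mulrA idem_arr eqxx scale1r.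
Qed.

Lemma word_runD a m n :
  word (run a m) * word (run (iter m nxt a) n) = word (run a (m + n)).
Proof. by rewrite -word_cat -trajectD. Qed.

(** Throughout this part [nxt a] is the arrow that follows [a] on its special
    cycle and [len a] is the length of the full power of that cycle, so that
    the full words are the socle paths, one for each starting arrow. *)
Definition full s := if s is a :: _ then s == run a (len a) else false.

Lemma full_run a n : full (run a n) = (n == len a).
Proof.
case: n => [|n] /=; first by rewrite eq_sym (gtn_eqF (len_gt0 a)).
apply/eqP/eqP => [/(congr1 size)/= |<-//].
by rewrite !size_traject.
Qed.

(** All full words with the same first arrow have the same length. *)
Lemma full_prefix s t : full s -> full (s ++ t) -> t = [::].
Proof.
case: s => //= a s /eqP sE /eqP stE; apply: size0nil.
have := congr1 size stE; have := congr1 size sE; rewrite /= size_cat !size_traject.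
by move=> <- [] /eqP; rewrite -[X in _ == X]addn0 eqn_add2l => /eqP.
Qed.

Lemma full_closed v s : walk v s -> full s -> walk_end v s = v.
Proof.
case: s => //= a s /andP[/eqP <- _] /eqP sE.
by rewrite -[LHS]/(walk_end (src a) (a :: s)) sE run_end iter_len.
Qed.

(** Rotating the full power of a cycle gives the full power of the same cycle
    read from another arrow; the form below is symmetric for this reason. *)
Lemma full_rot s t : full (s ++ t) -> full (t ++ s).
Proof.
case: s => [|a s]; first by rewrite cats0.
rewrite cat_cons [full _]/(_ == _) -cat_cons => /eqP; move: (a :: s) => {}s st.
have le_s : (size s <= len a)%N.
  by rewrite -(size_traject nxt a (len a)) -st size_cat leq_addr.
have sE : s = run a (size s) by rewrite -(take_traject _ _ le_s) -st take_size_cat.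
have tE : t = run (iter (size s) nxt a) (len a - size s).
  move: st; rewrite -{1}(subnKC le_s) trajectD -sE => /eqP.
  by rewrite eqseq_cat // eqxx /= => /eqP.
have -> : t ++ s = run (iter (size s) nxt a) (len a).
  have -> : run (iter (size s) nxt a) (len a) =
    run (iter (size s) nxt a) (len a - size s + size s) by rewrite subnK.
  by rewrite trajectD -iterD subnK // iter_len -tE -sE.
by rewrite full_run len_iter.
Qed.

Fact cycle_form_key : unit. Proof. exact: tt. Qed.
(** The symmetrizing form of a Brauer configuration algebra, written on the path
    algebra: it reads off the total coefficient of the socle paths. *)
Definition cycle_form : {scalar PA} :=
  locked_with cycle_form_key (pa_ext (fun p : qpath Q => (full p.2)%:R : K^o)).

Lemma form0 : cycle_form (0 : PA) = 0. Proof. exact: linear0. Qed.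
Lemma formD (x y : PA) : cycle_form (x + y) = cycle_form x + cycle_form y.
Proof. exact: linearD. Qed.
Lemma formB (x y : PA) : cycle_form (x - y) = cycle_form x - cycle_form y.
Proof. exact: linearB. Qed.
Lemma formZ k (x : PA) : cycle_form (k *: x) = k * cycle_form x.
Proof. exact: linearZ. Qed.

Lemma form_path p : cycle_form (path_elt K p) = (full p.2)%:R.
Proof.
rewrite /cycle_form unlock.
exact: (pa_ext_path (fun q : qpath Q => (full q.2)%:R : K^o) p).
Qed.

Lemma form_pathM p q : cycle_form (path_elt K p * path_elt K q) =
  ((pend p == pstart q) && full (p.2 ++ q.2))%:R.
Proof.
have [pq|pq] := eqVneq (pend p) (pstart q); last by rewrite path_eltM0 // form0.
by have [r -> vr] := path_eltM_cat K pq; rewrite form_path vr.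
Qed.

Lemma form_idem v : cycle_form (idem v) = 0.
Proof. by rewrite form_path. Qed.

Lemma form_word a s : cycle_form (word (a :: s)) = (full (a :: s))%:R.
Proof.
have [w|nw] := boolP (walk (src a) (a :: s)).
  by rewrite (word_path _ w) form_path.
rewrite word_not_walk // form0 /=; case: eqP nw => // sE.
by rewrite sE run_walk.
Qed.

Lemma form_words s t : s != [::] -> cycle_form (word s * word t) = (full (s ++ t))%:R.
Proof. by case: s => // a s _; rewrite -word_cat form_word. Qed.

Lemma form_run a n : (0 < n)%N -> cycle_form (word (run a n)) = (n == len a)%:R.
Proof. by move=> n_gt0; rewrite -full_run; case: n n_gt0 => // n _; rewrite form_word. Qed.

Lemma form_path_rot p q : (pend p == pstart q) && full (p.2 ++ q.2) ->
  (pend q == pstart p) && full (q.2 ++ p.2).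
Proof.
case/andP=> /eqP pq fpq; rewrite full_rot // andbT.
have [r _ vr] := path_eltM_cat K pq.
have w : walk p.1 (p.2 ++ q.2) by have := valP r; rewrite vr.
have := full_closed w fpq; rewrite /walk_end map_cat last_cat.
by rewrite -[last p.1 _]/(pend p) pq => e; apply/eqP; exact: e.
Qed.

Lemma form_comm x y : cycle_form (x * y) = cycle_form (y * x).
Proof.
elim/path_alg_ind: x => [|x x' IH IH'|k x IH|p].
- by rewrite mul0r mulr0.
- by rewrite mulrDl mulrDr !formD IH IH'.
- by rewrite -scalerAl -scalerAr !formZ IH.
elim/path_alg_ind: y => [|y y' IH IH'|k y IH|q].
- by rewrite mul0r mulr0.
- by rewrite mulrDl mulrDr !formD IH IH'.
- by rewrite -scalerAl -scalerAr !formZ IH.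
rewrite !form_pathM; congr (_%:R); congr nat_of_bool.
by apply/idP/idP; exact: form_path_rot.
Qed.

(** As the form is symmetric this one-sided radical is a two-sided ideal, the
    largest one on which the form vanishes. The purpose of this part is to
    identify it with the ideal of relations. *)
Definition form_rad : set PA := [set x | forall z, cycle_form (x * z) = 0].

Lemma form_rad_ideal : is_ideal form_rad.
Proof.
split; first split.
- by move=> z; rewrite mul0r form0.
- by move=> x y x0 y0 z; rewrite mulrDl formD x0 y0 addr0.
- by move=> a x x0 z; rewrite form_comm mulrA form_comm x0.
- by move=> a x x0 z; rewrite -mulrA.
Qed.

Lemma form_radP x :
  (forall q, cycle_form (x * path_elt K q) = 0) -> form_rad x.
Proof.
move=> xq0; elim/path_alg_ind=> [|y z IHy IHz|k y IH|//].
- by rewrite mulr0 form0.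
- by rewrite mulrDr formD IHy IHz addr0.
- by rewrite -scalerAr formZ IH mulr0.
Qed.

(** A word that is not a run makes somewhere a step other than [nxt], and a run
    longer than [len a] contains one of length [len a] plus one; so relations
    of the second and third type kill every path except the short runs. *)
Lemma vanishing_word (J : set PA) a s : is_ideal J ->
  (forall a, J (word (run a (len a).+1))) ->
  (forall a b, b != nxt a -> J (arr K a * arr K b)) ->
  a :: s <> run a (size s).+1 \/ (len a <= size s)%N -> J (word (a :: s)).
Proof.
move=> JP J_long J_turn; have [/fpathE sE|/negP nf _] := boolP (fpath nxt a s).
  case=> [[]|le_s]; first by rewrite /= {1}sE.
  have -> : a :: s = run a ((len a).+1 + (size s - len a)).
    by rewrite addSn subnKC //= {1}sE.
  by rewrite -word_runD; apply: (ideal_mulr JP); exact: J_long.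
elim: s a nf => [|b s IHs] a //= /negP; rewrite negb_and.
rewrite word_cons => /orP[ab|/negP/IHs bs]; last first.
  by apply: (ideal_mull JP); apply: bs.
by rewrite word_cons mulrA; apply: (ideal_mulr JP); apply: J_turn; rewrite eq_sym.
Qed.

Lemma form_rad_long a : form_rad (word (run a (len a).+1)).
Proof.
apply: form_radP => q; rewrite word_run // form_pathM.
case: andP => // -[_]; rewrite val_insubd run_walk /=.
have := @full_prefix (run a (len a)) (iter (len a) nxt a :: q.2).
rewrite full_run eqxx -cat_rcons -trajectSr => /(_ isT) H /H.
by case.
Qed.

Lemma form_rad_turn a b : b != nxt a -> form_rad (arr K a * arr K b).
Proof.
move=> ab; apply: form_radP => q.
have [tab|/arrM0->] := eqVneq (tgt a) (src b); last by rewrite mul0r form0.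
have [r -> vr] := @path_eltM_cat K Q (arrow_path a) (arrow_path b) tab.
rewrite form_pathM vr /=; case: andP => // -[_ /eqP].
by rewrite -(prednK (len_gt0 a)) -(subnKC (len_gt1 a)) => -[ba]; rewrite ba eqxx in ab.
Qed.

(** Both full words are closed at the same vertex, and each pairs to one with the
    trivial path there and to zero with every other path. *)
Lemma form_rad_eq a b : src a = src b ->
  form_rad (word (run a (len a)) - word (run b (len b))).
Proof.
move=> ab; apply: form_radP => q; rewrite mulrBl formB !word_run ?len_gt0 //.
have fE c : src c = src a ->
    cycle_form (path_elt K (insubd (triv_path (src c)) (src c, run c (len c))) *
                path_elt K q) = (val q == (src a, [::]))%:R.
  move=> ca; rewrite form_pathM val_insubd run_walk /pend val_insubd run_walk /=.
  rewrite -/(walk_end _ _) run_end iter_len ca /pstart.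
  have fs s : full (run c (len c) ++ s) = (s == [::]).
    apply/idP/eqP => [h|->]; last by rewrite cats0 full_run.
    by apply: full_prefix h; rewrite full_run.
  by case: q => -[v s] ws /=; rewrite fs xpair_eqE eq_sym.
by rewrite !fE ?subrr.
Qed.

Section DualBasis.
Variables (J : set PA) (out : qvert Q -> qarrow Q).
Hypothesis JP : is_ideal J.
Hypothesis src_out : forall v, src (out v) = v.
Hypothesis J_eq : forall a b, src a = src b ->
  J (word (run a (len a)) - word (run b (len b))).
Hypothesis J_long : forall a, J (word (run a (len a).+1)).
Hypothesis J_turn : forall a b, b != nxt a -> J (arr K a * arr K b).

(** All socle paths at one vertex agree modulo the relations; [out] picks one. *)
Definition soc v : PA := word (run (out v) (len (out v))).

Local Notation segment := {a : qarrow Q & 'I_(len a)}.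
Definition seg (u : segment) : PA := word (run (tag u) (tagged u)).
(** The complement of a segment: together they form a full word. *)
Definition coseg (u : segment) : PA :=
  word (run (iter (tagged u) nxt (tag u)) (len (tag u) - tagged u)).

(** Trivial paths, proper segments of full words and socle paths span the
    quotient. Under the form, the first and the last family are dual to each
    other and a segment is dual to its complement; this is the expansion of an
    element with respect to that pair of dual bases. *)
Definition dual_expansion x : PA :=
  \sum_v cycle_form (x * soc v) *: idem v
  + \sum_(u : segment | (0 < tagged u)%N) cycle_form (x * coseg u) *: seg u
  + \sum_v cycle_form (x * idem v) *: soc v.

Lemma dual_expansion_linear : linear dual_expansion.
Proof.
have sumL (I : finType) (P : pred I) (y z : I -> PA) k a b :
    \sum_(i | P i) cycle_form ((k *: a + b) * y i) *: z i =
    k *: (\sum_(i | P i) cycle_form (a * y i) *: z i)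
    + \sum_(i | P i) cycle_form (b * y i) *: z i.
  rewrite scaler_sumr -big_split; apply: eq_bigr => i _ /=.
  by rewrite mulrDl -scalerAl formD formZ scalerDl scalerA.
move=> k a b; rewrite /dual_expansion !sumL !scalerDr.
by rewrite [X in X + _ = _]addrACA [LHS]addrACA.
Qed.

Lemma dual_expansion_idem v : dual_expansion (idem v) = idem v.
Proof.
have f0 c n : (0 < n)%N -> (n < len c)%N ->
    cycle_form (idem v * word (run c n)) = 0.
  case: n => // n _ nc; rewrite /= word_cons mulrA idem_arr -scalerAl formZ.
  rewrite -word_cons -[_ :: _]/(run c n.+1) form_run //.
  by rewrite (ltn_eqF nc) mulr0.
rewrite /dual_expansion [X in _ + X + _]big1; last first.
  move=> -[a n] /= n_gt0; rewrite f0 ?scale0r ?subn_gt0 //.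
  by rewrite len_iter ltn_subrL n_gt0 len_gt0.
rewrite [X in _ + X]big1 => [|w _]; last first.
  by rewrite idemM formZ form_idem mulr0 scale0r.
rewrite !addr0 (bigD1 v) //= [X in _ + X]big1; last first.
  move=> w wv; rewrite /soc -(prednK (len_gt0 _)) /= word_cons mulrA idem_arr.
  by rewrite src_out eq_sym (negbTE wv) scale0r mul0r form0 scale0r.
rewrite addr0 /soc; set c := out v; have lc := len_gt0 c.
rewrite -{1}(src_out v) word_run // idem_path /pstart val_insubd run_walk eqxx.
by rewrite scale1r -word_run // form_run // eqxx scale1r.
Qed.

Lemma form_run_soc a n v : (0 < n)%N -> cycle_form (word (run a n) * soc v) = 0.
Proof.
move=> n_gt0; rewrite form_comm form_words; last first.
  by rewrite -size_eq0 size_traject -lt0n len_gt0.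
have [h|//] := boolP (full _); have := full_prefix _ h.
rewrite full_run eqxx => /(_ isT) /(congr1 size).
by rewrite size_traject => n0; rewrite n0 in n_gt0.
Qed.

(** The last arrow of the complement has to close up the run, which fixes both
    the position and, lengths being constant on a cycle, the starting arrow. *)
Lemma form_run_coseg a n (u : segment) : (0 < n)%N -> (0 < tagged u)%N ->
  cycle_form (word (run a n) * coseg u)
  = ((a == tag u) && (n == tagged u))%:R.
Proof.
case: u => b m /= n_gt0 m_gt0; rewrite form_words; last first.
  by rewrite -size_eq0 size_traject -lt0n.
congr (_%:R); congr nat_of_bool; apply/idP/andP => [|[/eqP-> /eqP->]]; last first.
  have lm := ltnW (ltn_ord m).
  by rewrite -trajectD subnKC // full_run.
rewrite -(prednK n_gt0) /= => /eqP; rewrite -cat_cons -trajectS prednK // => rE.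
have lt_mb : (0 < len b - m)%N by rewrite subn_gt0.
have sz : (n + (len b - m))%N = len a.
  by have := congr1 size rE; rewrite size_cat !size_traject.
move: rE; rewrite -sz trajectD => /eqP.
rewrite eqseq_cat ?size_traject // eqxx -(prednK lt_mb) /= eqseq_cons.
case/andP=> /eqP bm _; have lab : len a = len b.
  by rewrite -(len_iter n a) -bm len_iter.
have mn : n = m.
  apply/eqP; rewrite -(eqn_add2r (len b - m)) sz subnKC ?lab //.
  exact: ltnW.
rewrite mn in bm *; split=> //; apply/eqP/esym; exact: iter_nxt_inj bm.
Qed.

Lemma form_run_idem a n v : (0 < n)%N ->
  cycle_form (word (run a n) * idem v)
  = ((n == len a) && (v == src a))%:R.
Proof.
move=> n_gt0; rewrite word_run // path_idem formZ -word_run // form_run //.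
rewrite /pend val_insubd run_walk /= -/(walk_end _ _) run_end -natrM mulnb.
case: (eqVneq n (len a)) => [->|_]; last by rewrite andbF.
by rewrite andbT iter_len eq_sym.
Qed.

Lemma dual_expansion_run a n : (0 < n)%N -> (n <= len a)%N ->
  dual_expansion (word (run a n)) =
  if n == len a then soc (src a) else word (run a n).
Proof.
move=> n_gt0 le_n; rewrite /dual_expansion.
rewrite [X in X + _ + _]big1 ?add0r => [|v _]; last first.
  by rewrite form_run_soc // scale0r.
have [->|n_neq] := eqVneq n (len a).
  rewrite [X in X + _]big1 ?add0r => [|u u_gt0]; last first.
    rewrite form_run_coseg ?len_gt0 //; case: u u_gt0 => b m /= _.
    case: eqP => [->|]; last by rewrite scale0r.
    by rewrite eq_sym (ltn_eqF (ltn_ord m)) scale0r.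
  rewrite (bigD1 (src a)) //= form_run_idem ?len_gt0 // !eqxx scale1r.
  rewrite big1 ?addr0 // => v /negbTE va.
  by rewrite form_run_idem ?len_gt0 // va andbF scale0r.
rewrite [X in _ + X]big1 ?addr0 => [|v _]; last first.
  by rewrite form_run_idem // (negbTE n_neq) scale0r.
have lt_n : (n < len a)%N by rewrite ltn_neqAle n_neq.
(* Of all segments only the run itself contributes. *)
pose u0 : segment := Tagged (fun a => 'I_(len a)) (Ordinal lt_n).
rewrite (bigD1 u0) //= form_run_coseg // !eqxx scale1r.
rewrite big1 ?addr0 // => -[b m] /= /andP[m_gt0 neq_u].
rewrite form_run_coseg //=; have [ba|_] := eqVneq a b; last by rewrite scale0r.
have [nm|_] := eqVneq n m; last by rewrite scale0r.
by subst b; case/eqP: neq_u; rewrite /u0; congr existT; exact: val_inj.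
Qed.

(** Check on paths: a trivial path or a proper segment is its own expansion, a
    full word expands to the chosen socle path at its vertex, and any other path
    is killed by the relations and by the form alike. *)
Lemma dual_expansion_path p : J (path_elt K p - dual_expansion (path_elt K p)).
Proof.
case: p => -[v s] w; case: s w => [|a s] w.
  have -> : path_elt K (QPath w) = idem v by congr path_elt; exact: val_inj.
  by rewrite dual_expansion_idem subrr; exact: ideal_zero.
have va : v = src a by case/andP: (w) => /eqP.
subst v; rewrite -(word_path _ w).
have [/andP[/eqP -> le_s]|bad] :=
    boolP ((a :: s == run a (size s).+1) && (size s < len a)%N).
  rewrite dual_expansion_run //; case: eqP => [->|_]; last first.
    by rewrite subrr; exact: ideal_zero.
  by apply: J_eq; rewrite src_out.
have {}bad : a :: s <> run a (size s).+1 \/ (len a <= size s)%N.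
  by move: bad; rewrite negb_and -leqNgt => /orP[/eqP|]; [left | right].
have y0 := vanishing_word form_rad_ideal form_rad_long form_rad_turn bad.
rewrite /dual_expansion !big1 ?addr0 ?subr0 => [|*|*|*];
  try by rewrite y0 scale0r.
exact: vanishing_word.
Qed.

Lemma dual_expansionP x : J (x - dual_expansion x).
Proof.
pose D : {linear PA -> PA} := mk_linear dual_expansion_linear.
have D0 : dual_expansion 0 = 0 := linear0 D.
have DD y z : dual_expansion (y + z) = dual_expansion y + dual_expansion z.
  exact: (linearD D).
have DZ k y : dual_expansion (k *: y) = k *: dual_expansion y.
  by rewrite -[k *: y]addr0 dual_expansion_linear D0 addr0.
elim/path_alg_ind: x => [|x y Jx Jy|k x Jx|p].
- by rewrite D0 subrr; exact: ideal_zero.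
- by rewrite DD opprD addrACA; exact: ideal_add.
- by rewrite DZ -scalerBr; exact: ideal_scale.
- exact: dual_expansion_path.
Qed.

(** The coefficients of the dual expansion of a radical element are all zero. *)
Lemma form_rad_sub : form_rad `<=` J.
Proof.
move=> x x0; have := dual_expansionP x.
by rewrite /dual_expansion !big1 ?addr0 ?subr0 // => *; rewrite x0 scale0r.
Qed.

Lemma form_long : exists N, forall x q, cycle_form (x * path_elt K q) != 0 ->
  (size q.2 <= N)%N.
Proof.
exists (\max_a len a) => x q; rewrite leqNgt; apply: contra => lt_q.
apply/eqP; elim/path_alg_ind: x => [|x y IHx IHy|k x IH|p].
- by rewrite mul0r form0.
- by rewrite mulrDl formD IHx IHy addr0.
- by rewrite -scalerAl formZ IH mulr0.
rewrite form_comm form_pathM; case: andP => // -[_].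
case: (q.2) lt_q => // a s lt_q /eqP/(congr1 size); rewrite size_traject size_cat.
move=> sz; have := leq_bigmax a (F := len); rewrite -sz leqNgt.
by rewrite (leq_trans lt_q) ?leq_addr.
Qed.

(** An element that pairs nontrivially with some path can be multiplied by the
    longest such path; what remains pairs only with trivial paths, so its dual
    expansion is a combination of socle paths. An ideal containing it would
    contain one of them. *)
Lemma sub_form_rad : (forall a, ~ J (word (run a (len a)))) -> J `<=` form_rad.
Proof.
move=> Jsoc x Jx; apply: form_radP => q0; apply/eqP; apply: contraT => xq0.
have [N long] := form_long.
(* A path of maximal length pairing nontrivially with x. *)
pose P n := `[< exists2 q : qpath Q, size q.2 = n &
                 cycle_form (x * path_elt K q) != 0 >].
have exP : exists n, P n by exists (size q0.2); apply/asboolP; exists q0.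
have ubP n : P n -> (n <= N)%N by case/asboolP=> q <- /long.
case: (ex_maxnP exP ubP) => n /asboolP[q sq xq] maxn.
set y := x * path_elt K q in xq.
have Jy : J y by exact: ideal_mulr.
have y0 c m : (0 < m)%N -> cycle_form (y * word (run c m)) = 0.
  move=> m_gt0; apply/eqP; apply: contraT; rewrite word_run // -mulrA.
  set r := insubd _ _; have rE : val r = (src c, run c m).
    by rewrite val_insubd run_walk.
  have [qr|/path_eltM0->] := eqVneq (pend q) (pstart r); last first.
    by rewrite mulr0 form0 eqxx.
  have [t -> vt] := path_eltM_cat K qr => xt.
  have /maxn : P (size (val t).2) by apply/asboolP; exists t.
  by rewrite vt /= size_cat sq rE /= size_traject -{2}(addn0 n) leq_add2l leqNgt m_gt0.
have yE : J (\sum_v cycle_form (y * idem v) *: soc v).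
  have := ideal_sub JP Jy (dual_expansionP y); rewrite opprB addrC subrK.
  rewrite /dual_expansion big1 ?add0r => [|v _]; last by rewrite y0 ?scale0r ?len_gt0.
  by rewrite big1 ?add0r // => u _; rewrite y0 ?scale0r ?subn_gt0.
have [v fv] : exists v, cycle_form (y * idem v) != 0.
  apply/existsP; apply: contraNT xq; rewrite negb_exists => /forallP yv.
  rewrite -(mulr1 y) -idem_sum mulr_sumr linear_sum big1 // => v _.
  by apply/eqP; move: (yv v); rewrite negbK.
have Jv : J (cycle_form (y * idem v) *: soc v).
  have := ideal_mull JP (idem v) yE.
  rewrite mulr_sumr (bigD1 v) //= big1 ?addr0 => [|w wv]; last first.
    rewrite -scalerAr /soc -(prednK (len_gt0 _)) /= word_cons mulrA idem_arr.
    by rewrite src_out eq_sym (negbTE wv) scale0r mul0r scaler0.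
  rewrite -scalerAr /soc; set c := out v; have lc := len_gt0 c.
  rewrite -{2}(src_out v) word_run // idem_path /pstart val_insubd run_walk eqxx.
  by rewrite scale1r -word_run.
case: (Jsoc (out v)); have := ideal_scale (cycle_form (y * idem v))^-1 JP Jv.
by rewrite scalerA mulVf // scale1r.
Qed.

End DualBasis.
End CycleForm.

(** * Brauer configuration algebras are symmetric and multiserial *)

(** Any ideal of the quotient on which the induced form vanishes lifts into the
    radical of the form. *)
Lemma radical_quot_symmetric (K : fieldType) (Q : quiver)
    (I : two_sided_ideal (path_alg K Q)) (f : {scalar path_alg K Q}) :
  (forall x y, f (x * y) = f (y * x)) ->
  (forall x, ideal_set I x <-> forall z, f (x * z) = 0) ->
  symmetric_alg (quot_alg I).
Proof.
move=> fC If.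
have f0 x : ideal_set I x -> f x = 0 by move=> /If/(_ 1); rewrite mulr1.
have fproj x : f (qrepr (qpr I x)) = f x.
  apply/eqP; rewrite eq_sym -subr_eq0 -linearB; apply/eqP/f0.
  by rewrite qprE; exact: qreprP.
have gL : scalar (fun x : quot_alg I => f (qrepr x)).
  move=> k x y; rewrite -(qreprE x) -(qreprE y) -(linearP (qpr I)) !fproj.
  exact: linearP.
exists (mk_scalar gL); split=> [x y|J JP J0 x Jx] /=.
  by rewrite -(qreprE x) -(qreprE y) -!(rmorphM (qpr I)) !fproj.
rewrite -(qreprE x); apply/qpr_eq0/If => z; rewrite -fproj; apply: J0.
by rewrite rmorphM /= qreprE; exact: (ideal_mulr JP).
Qed.

Section BrauerIdeal.
Variables (K : fieldType) (G : brauer_config).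
Local Notation BQ := (brauer_quiver G).
Local Notation word := (@word K BQ).

Definition bnext (a : qarrow BQ) : qarrow BQ :=
  barrow (valP a) (ordS (tagged (val a))).
Definition blen (a : qarrow BQ) : nat :=
  (bval (tag (val a)) * bmult (tag (val a)))%N.
Local Notation run := (traject bnext).

Lemma bnext_barrow (x : bvert G) (nx : ~~ truncated x) i :
  bnext (barrow nx i) = barrow nx (ordS i).
Proof. exact: val_inj. Qed.

Lemma barrowK (a : qarrow BQ) : a = barrow (valP a) (tagged (val a)).
Proof. by apply: val_inj; case: a => -[]. Qed.

Lemma run_barrow (x : bvert G) (nx : ~~ truncated x) i n :
  run (barrow nx i) n = [seq barrow nx j | j <- traject (@ordS (bval x)) i n].
Proof. by elim: n i => //= n IHn i; rewrite bnext_barrow IHn. Qed.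

Lemma iter_ordS n (i : 'I_n) k : iter k (@ordS n) i = ((i + k) %% n)%N :> nat.
Proof.
elim: k => [|k IHk]; first by rewrite addn0 modn_small.
by rewrite iterS /= IHk -[((_ %% n).+1)%N]addn1 modnDml addn1 addnS.
Qed.

Lemma iter_bval (x : bvert G) (nx : ~~ truncated x) i m :
  iter (bval x * m) bnext (barrow nx i) = barrow nx i.
Proof.
have iterE k j : iter k bnext (barrow nx j) = barrow nx (iter k (@ordS _) j).
  by elim: k => //= k ->; rewrite bnext_barrow.
rewrite iterE; congr barrow; apply: val_inj.
by rewrite /= iter_ordS addnC mulnC modnMDl modn_small.
Qed.

Lemma cycle_expE (x : bvert G) (nx : ~~ truncated x) i m :
  cycle_elt K nx i ^+ m = word (run (barrow nx i) (bval x * m)).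
Proof.
have -> : cycle_elt K nx i = word (run (barrow nx i) (bval x)).
  by rewrite run_barrow.
elim: m => [|m IHm]; first by rewrite muln0 expr0 /word big_nil.
have := iter_bval nx i 1; rewrite muln1 => turn1.
by rewrite exprS IHm mulnS trajectD word_cat turn1.
Qed.

Lemma tgt_bnext (a : qarrow BQ) : tgt a = src (bnext a).
Proof. by []. Qed.

Lemma blen_bnext (a : qarrow BQ) : blen (bnext a) = blen a.
Proof. by []. Qed.

Lemma iter_blen (a : qarrow BQ) : iter (blen a) bnext a = a.
Proof. by rewrite {2 3}(barrowK a); exact: iter_bval. Qed.

Lemma blen_gt1 (a : qarrow BQ) : (1 < blen a)%N.
Proof.
case: a => -[x i] nx /=; rewrite /blen /= ltn_neqAle eq_sym nx /=.
by rewrite muln_gt0 bmult_gt0 (leq_trans _ (ltn_ord i)).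
Qed.

Lemma bout_exists (V : qvert BQ) : exists a : qarrow BQ, src a == V.
Proof.
have [x xV x_gt1] := polygon_nontruncated V.
have /tnthP[i Vi] : V \in orient x.
  by rewrite -has_pred1 has_count orient_count mset_gt0.
have nx : ~~ truncated x by rewrite /truncated gtn_eqF.
by exists (barrow nx i); rewrite Vi.
Qed.

Definition bout (V : qvert BQ) : qarrow BQ := xchoose (bout_exists V).

Lemma src_bout V : src (bout V) = V.
Proof. exact/eqP/(xchooseP (bout_exists V)). Qed.

Local Notation brad := (@form_rad K BQ bnext blen).

Lemma run_blen (a : qarrow BQ) : word (run a (blen a)) =
  cycle_elt K (valP a) (tagged (val a)) ^+ bmult (tag (val a)).
Proof. by rewrite cycle_expE -barrowK. Qed.

Lemma brauer_ideal_eq (a b : qarrow BQ) : src a = src b ->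
  ideal_set (brauer_ideal K G) (word (run a (blen a)) - word (run b (blen b))).
Proof.
move=> ab; apply: sub_ideal_gen.
by rewrite !run_blen; exact: BrauerRel1.
Qed.

Lemma brauer_ideal_long (a : qarrow BQ) :
  ideal_set (brauer_ideal K G) (word (run a (blen a).+1)).
Proof.
apply: sub_ideal_gen; rewrite trajectSr iter_blen -cats1 word_cat run_blen.
have -> : word [:: a] = arr K (barrow (valP a) (tagged (val a))).
  by rewrite -barrowK /word big_seq1.
exact: BrauerRel2.
Qed.

Lemma infix_special (x : bvert G) (nx : ~~ truncated x) i (a b : qarrow BQ) :
  infix [:: a; b] (special_cycle nx i) -> b = bnext a.
Proof.
rewrite -[special_cycle nx i]run_barrow => /infixP[s [t]].
elim: s (barrow nx i) (bval x) => [|c s IHs] d [|n] //=; last by case=> _; exact: IHs.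
by case=> <-; case: n => //= n [<-].
Qed.

Lemma brauer_ideal_turn (a b : qarrow BQ) : b != bnext a ->
  ideal_set (brauer_ideal K G) (arr K a * arr K b).
Proof.
move=> ab; have [tab|/arrM0->] := eqVneq (tgt a) (src b); last first.
  by apply: ideal_zero; exact: ideal_genP.
apply: sub_ideal_gen; apply: BrauerRel3 => //.
  by move=> x nx i; apply: contra ab => /infix_special ->.
case=> ab' [bval1 _]; case/eqP: ab; rewrite -ab' {1}(barrowK a); congr barrow.
apply: val_inj; move: (tagged (val a)); rewrite bval1 => i.
by rewrite [i]ord1 [ordS _]ord1.
Qed.

(** One inclusion needs only the three types of generators; the other is the
    dual expansion. Hence the Brauer configuration algebra carries a
    nondegenerate form. *)
Lemma brauer_idealE : brauer_ideal K G = brad :> set _.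
Proof.
have radP := form_rad_ideal K tgt_bnext blen_bnext iter_blen blen_gt1.
apply/seteqP; split.
  apply: ideal_gen_sub radP _ => _ [x y nx ny i j ij|x nx i|a b tab nab nloop].
  - by rewrite !cycle_expE; exact: (form_rad_eq tgt_bnext iter_blen blen_gt1).
  - rewrite cycle_expE; have -> : arr K (barrow nx i) = word [:: barrow nx i].
      by rewrite /word big_seq1.
    rewrite -word_cat cats1 -{2}(iter_bval nx i (bmult x)) -trajectSr.
    exact: (form_rad_long tgt_bnext blen_gt1).
  - apply: (form_rad_turn blen_gt1); apply/eqP => ab; apply: nloop.
    case: a ab tab nab => -[x i] nx ab tab nab /=; move: (nab x nx i); rewrite ab.
    have [bv_gt1 /negP[]|bv_le1 _] := ltnP 1 (bval x).
      have infix_run d n : (1 < n)%N -> infix [:: d; bnext d] (run d n).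
        by case: n => [|[|n]] // _; apply: (prefix_infix _); rewrite /= !eqxx prefix0s.
      rewrite -[special_cycle nx i]run_barrow; exact: infix_run.
    have bv1 : bval x = 1%N.
      by apply/eqP; rewrite eqn_leq bv_le1 (leq_trans _ (ltn_ord i)).
    split; first last.
      split=> //; have := blen_gt1 (barrow nx i).
      by rewrite /blen /= bv1 mul1n.
    have ord_eq0 (j : 'I_(bval x)) : j = 0%N :> nat.
      by case: j => j /=; rewrite bv1 ltnS leqn0 => /eqP.
    by apply: val_inj => /=; congr existT; apply: ord_inj; rewrite !ord_eq0.
apply: (form_rad_sub tgt_bnext blen_bnext iter_blen blen_gt1 _ src_bout).
- exact: ideal_genP.
- exact: brauer_ideal_eq.
- exact: brauer_ideal_long.
- exact: brauer_ideal_turn.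
Qed.

Lemma brauer_symmetric : symmetric_alg (brauer_alg K G).
Proof.
apply: (radical_quot_symmetric (f := @cycle_form K BQ bnext blen)).
  exact: (form_comm tgt_bnext blen_bnext iter_blen blen_gt1).
by move=> x; rewrite /= [ideal_gen _]brauer_idealE.
Qed.

Lemma brauer_admissible : admissible (brauer_ideal K G).
Proof.
have word_long (a : qarrow BQ) (s : seq (qarrow BQ)) n :
    (n <= size s)%N -> long n (word s).
  move=> le_n p lt_p; apply: (@long_word K BQ); exact: leq_trans lt_p le_n.
have IP : is_ideal (brauer_ideal K G) := ideal_genP _.
split.
  exists (\max_a blen a).+2 => //; rewrite arrow_exp_long.
  apply: long_sub => // p lt_p; rewrite path_eltE; apply: (ideal_mull IP).
  case: (p.2) lt_p => // a s lt_s.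
  apply: (vanishing_word (nxt := bnext) (len := blen)) => //.
  - exact: brauer_ideal_long.
  - exact: brauer_ideal_turn.
  - by right; apply: leq_trans (leq_bigmax a) _; exact: ltnW.
rewrite arrow_exp_long; apply: ideal_gen_sub; first exact: long_ideal.
have gt1 (x : bvert G) (nx : ~~ truncated x) i := blen_gt1 (barrow nx i).
move=> _ [x y nx ny i j _|x nx i|a b _ _ _].
- rewrite !cycle_expE; apply: (ideal_sub (@long_ideal K BQ 2)).
  + by apply: word_long; rewrite ?size_traject; [exact: barrow nx i | exact: gt1].
  + by apply: word_long; rewrite ?size_traject; [exact: barrow nx i | exact: gt1].
- rewrite cycle_expE; apply: (ideal_mulr (@long_ideal K BQ 2)).
  by apply: word_long; rewrite ?size_traject; [exact: barrow nx i | exact: gt1].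
- by apply: (@longM _ _ 1 1); exact: long_path.
Qed.

Lemma brauer_multiserial : multiserial_cond (brauer_ideal K G).
Proof.
have turn a b : ~ ideal_set (brauer_ideal K G) (arr K a * arr K b) -> b = bnext a.
  by move=> nab; apply/eqP; apply: contra_notT nab => /brauer_ideal_turn.
move=> a; split=> [b b' /turn-> /turn->//|c c' /turn ac /turn ac'].
by apply: (nxt_inj blen_bnext iter_blen blen_gt1); rewrite -ac -ac'.
Qed.

End BrauerIdeal.

(** * Restriction of scalars along an isomorphism *)

(** The morphism occurs in the type only, to select the module structure. *)
Definition restr (R S : pzRingType) (phi : {rmorphism R -> S}) (M : lmodType S) :
  Type := M.
HB.instance Definition _ R S phi (M : lmodType S) :=
  GRing.Zmodule.on (@restr R S phi M).

Section RestrictionOfScalars.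
Variables (R S : pzRingType) (phi : {rmorphism R -> S}) (M : lmodType S).

Definition restr_scale (a : R) (x : restr phi M) : restr phi M :=
  (phi a *: (x : M)).

Fact restr_scaleA a b x :
  restr_scale a (restr_scale b x) = restr_scale (a * b) x.
Proof. by rewrite /restr_scale scalerA rmorphM. Qed.
Fact restr_scale1 : left_id 1 restr_scale.
Proof. by move=> x; rewrite /restr_scale rmorph1 scale1r. Qed.
Fact restr_scaleDr : right_distributive restr_scale +%R.
Proof. by move=> a x y; rewrite /restr_scale scalerDr. Qed.
Fact restr_scaleDl x : {morph restr_scale^~ x : a b / a + b}.
Proof. by move=> a b; rewrite /restr_scale rmorphD scalerDl. Qed.

HB.instance Definition _ := GRing.Zmodule_isLmodule.Build R (restr phi M)
  restr_scaleA restr_scale1 restr_scaleDr restr_scaleDl.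

End RestrictionOfScalars.

Section RestrictionFunctor.
Variables (K : pzRingType) (A B : algType K) (phi : {lrmorphism A -> B}).

Fact restr_map_linear (M N : lmodType B) (f : {linear M -> N}) :
  linear (f : restr phi M -> restr phi N).
Proof. by move=> a x y; exact: linearP. Qed.

Definition restr_functor : mod_functor B A.
Proof.
exists (fun M => restr phi M : lmodType A)
       (fun M N f => mk_linear (@restr_map_linear M N f)) => //.
move=> M N k f g h hE y; rewrite [LHS]hE; congr (_ + _).
have -> : k%:A = phi k%:A by rewrite linearZ /= rmorph1.
by [].
Defined.

End RestrictionFunctor.

Lemma alg_iso_morita (K : pzRingType) (A B : algType K) :
  alg_iso A B -> morita_equivalent A B.
Proof.
move=> /alg_isoP[f [g [fK gK]]].
have etaL (M : lmodType A) : linear (id : M -> restr f (restr g M)).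
  by move=> a x y; congr (_ + _); rewrite -[in LHS](fK a).
have epsL (N : lmodType B) : linear (id : restr g (restr f N) -> N).
  by move=> a x y; congr (_ + _); rewrite -[in RHS](gK a).
exists (restr_functor g), (restr_functor f),
  (fun M => mk_linear (@etaL M)), (fun N => mk_linear (@epsL N)).
by split=> // M; exists id.
Qed.

(** * Morita equivalent basic algebras *)

Local Notation fmap := Defs.fmap.
Local Notation fmap_id := Defs.fmap_id.
Local Notation fmap_comp := Defs.fmap_comp.

Section MapFunctor.
Variables (K : pzRingType) (A B : algType K) (F : mod_functor A B).

Lemma fmap_ext (M N : lmodType A) (f g : {linear M -> N}) :
  f =1 g -> fmap F f =1 fmap F g.
Proof.
move=> fg x; have := @fmap_comp K A B F M N N f idfun g.
by move=> /(_ (fun x => esym (fg x)) x) /= ->; rewrite fmap_id.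
Qed.

Lemma fmap_eq0 (M N : lmodType A) (f : {linear M -> N}) :
  (forall x, f x = 0) -> forall x, fmap F f x = 0.
Proof.
move=> f0 x; have fE y : f y = (-1)%:A *: f y + f y.
  by rewrite f0 scaler0 addr0.
by rewrite (fmap_linear (m := F) fE) !scaleN1r addNr.
Qed.

End MapFunctor.

Definition equivalence_data (K : pzRingType) (A B : algType K)
    (F : mod_functor A B) (G : mod_functor B A)
    (eta : forall M : lmodType A, {linear M -> G (F M)})
    (eps : forall N : lmodType B, {linear F (G N) -> N}) : Prop :=
  [/\ forall M, bijective (eta M),
      forall N, bijective (eps N),
      forall (M M' : lmodType A) (f : {linear M -> M'}),
        eta M' \o f =1 fmap G (fmap F f) \o eta M &
      forall (N N' : lmodType B) (g : {linear N -> N'}),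
        eps N' \o fmap F (fmap G g) =1 g \o eps N].

Lemma equivalence_data_sym (K : pzRingType) (A B : algType K)
    (F : mod_functor A B) (G : mod_functor B A) eta eps :
  equivalence_data (F := F) (G := G) eta eps ->
  exists eta' eps', equivalence_data (F := G) (G := F) eta' eps'.
Proof.
case=> etaB epsB etaN epsN.
have inv (R : pzRingType) (U V : lmodType R) (f : {linear U -> V}) :
    bijective f -> {g : {linear V -> U} | cancel f g /\ cancel g f}.
  move=> fB; apply: cid; case: fB => g fK gK.
  have gL : linear g by move=> k x y; apply: (can_inj fK); rewrite linearP /= !gK.
  by exists (mk_linear gL).
pose eta' N := sval (inv _ _ _ _ (epsB N)).
pose eps' M := sval (inv _ _ _ _ (etaB M)).
have eta'K N : cancel (eps N) (eta' N) /\ cancel (eta' N) (eps N).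
  exact: svalP (inv _ _ _ _ (epsB N)).
have eps'K M : cancel (eta M) (eps' M) /\ cancel (eps' M) (eta M).
  exact: svalP (inv _ _ _ _ (etaB M)).
exists eta', eps'; split.
- by move=> N; have [] := eta'K N; exists (eps N).
- by move=> M; have [] := eps'K M; exists (eta M).
- move=> N N' g x /=; have [e1 e2] := eta'K N; have [e1' e2'] := eta'K N'.
  apply: (can_inj e1'); rewrite e2' -{1}(e2 x).
  exact/esym/epsN.
- move=> M M' f y /=; have [e1 e2] := eps'K M; have [e1' e2'] := eps'K M'.
  by apply: (can_inj e1'); rewrite e2' -{1}(e2 y); apply: esym; apply: etaN.
Qed.

(** The form in which basicness over a splitting field is used: the algebra has
    characters that can be separated by elements, and their common kernel is nil. *)
Definition split_basic (K : fieldType) (A : algType K) : Prop :=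
  exists (V : finType) (eps : V -> {lrmorphism A -> K^o}) (e : V -> A),
    (forall v w, eps w (e v) = (v == w)%:R) /\
    (forall x, (forall v, eps v x = 0) -> exists n, x ^+ n = 0).

Section SplitBasic.
Variables (K : fieldType) (A : algType K) (V : finType).
Variables (chi : V -> {lrmorphism A -> K^o}).
Hypothesis chi_nil : forall x, (forall v, chi v x = 0) -> exists n, x ^+ n = 0.

(** Such an element is one minus a nilpotent element. *)
Lemma split_basic_linv u : (forall v, chi v u = 1) -> exists w, w * u = 1.
Proof.
move=> u1; have [|n xn] := @chi_nil (1 - u).
  by move=> v; rewrite rmorphB rmorph1 /= u1 subrr.
have uE : u = 1 - (1 - u) by rewrite subKr.
move: (1 - u) uE xn => x -> xn; exists (\sum_(i < n) x ^+ i).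
have comm_x : GRing.comm x (\sum_(i < n) x ^+ i).
  by apply: commr_sum => i _; exact/commrX/commr_refl.
rewrite mulrBr mulr1 -comm_x -[X in X - _]mul1r -mulrBl -opprB mulNr -subrX1.
by rewrite xn sub0r opprK.
Qed.

(** Every character takes the value one on the idempotent [d * c], so its
    complementary idempotent is nilpotent, hence zero. This replaces any
    appeal to dimensions. *)
Lemma split_basic_inv (c d : A) : c * d = 1 -> d * c = 1.
Proof.
move=> cd1; set y := 1 - d * c.
have yy : y * y = y.
  rewrite {1}/y mulrBl mul1r /y mulrBr mulr1 mulrA -(mulrA d) cd1 mulr1.
  by rewrite subrr subr0.
have [|n yn] := @chi_nil y.
  move=> v; rewrite rmorphB rmorph1 rmorphM /= (mulrC (chi v d)).
  by rewrite -[_ * _](rmorphM (chi v)) cd1 rmorph1 subrr.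
have yE m : y ^+ m.+1 = y by elim: m => // m IHm; rewrite exprS IHm.
have : y = 0 by rewrite -(yE n) exprS yn mulr0.
by move/eqP; rewrite subr_eq0 => /eqP.
Qed.

End SplitBasic.

Section EquivalenceData.
Variables (K : pzRingType) (A B : algType K).
Variables (F : mod_functor A B) (G : mod_functor B A).
Variables (eta : forall M : lmodType A, {linear M -> G (F M)}).
Variables (eps : forall N : lmodType B, {linear F (G N) -> N}).
Hypothesis FG : equivalence_data eta eps.

Lemma fmapF_inj (M M' : lmodType A) (f : {linear M -> M'}) :
  (forall y, fmap F f y = 0) -> forall x, f x = 0.
Proof.
case: FG => etaB _ etaN _ F0 x; apply: (bij_inj (etaB M')).
have /= -> := etaN _ _ f x.
by rewrite linear0; apply: fmap_eq0.
Qed.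

Lemma fmapG_inj (N N' : lmodType B) (g g' : {linear N -> N'}) :
  fmap G g =1 fmap G g' -> g =1 g'.
Proof.
case: FG => _ epsB _ epsN gg' y; have [e eK Ke] := epsB N.
rewrite -(Ke y); have /= <- := epsN _ _ g (e y).
have /= <- := epsN _ _ g' (e y).
by congr (eps _ _); apply: fmap_ext.
Qed.

Fact orbit_map_linear (N : lmodType A) (n : N) :
  linear ((fun a => a *: n) : A^o -> N).
Proof. by move=> a x y; rewrite scalerDl scalerA. Qed.

Definition orbit_map (N : lmodType A) (n : N) : {linear A^o -> N} :=
  mk_linear (orbit_map_linear n).

(** The image of [n] under the adjunction that identifies maps from the
    image of the regular module to [N] with elements of [G N]. *)
Definition adjunct (N : lmodType B) (n : G N) : {linear F A^o -> N} :=
  eps N \o fmap F (orbit_map n).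

Lemma adjunct_eq0 (N : lmodType B) (n : G N) :
  (forall y, adjunct n y = 0) -> n = 0.
Proof.
move=> n0; have [_ epsB _ _] := FG.
have /(_ 1) : forall x, orbit_map n x = 0.
  apply: fmapF_inj => y; apply: (bij_inj (epsB N)).
  by rewrite linear0; exact: n0.
by rewrite /= scale1r.
Qed.

Lemma adjunct_map (N N' : lmodType B) (g : {linear N -> N'}) (n : G N) y :
  adjunct (fmap G g n) y = g (adjunct n y).
Proof.
have [_ _ _ epsN] := FG; have /= <- := epsN _ _ g (fmap F (orbit_map n) y).
congr (eps _ _).
have E : orbit_map (fmap G g n) =1 fmap G g \o orbit_map n.
  by move=> a /=; rewrite linearZ.
exact: (fmap_comp (m := F) E y).
Qed.

End EquivalenceData.

Section BasicQuotient.
Variables (K : fieldType) (A B : algType K).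
Variables (F : mod_functor A B) (G : mod_functor B A).
Variables (eta : forall M : lmodType A, {linear M -> G (F M)}).
Variables (eps : forall N : lmodType B, {linear F (G N) -> N}).
Hypothesis FG : equivalence_data eta eps.
Variables (V : finType) (chi : V -> {lrmorphism B -> K^o}) (e : V -> B).
Hypothesis chi_idem : forall v w, chi w (e v) = (v == w)%:R.
Hypothesis chi_nil : forall x, (forall v, chi v x = 0) -> exists n, x ^+ n = 0.

Fact chi_module_linear v :
  linear (chi v : B^o -> restr (chi v) (K^o^o)).
Proof. by move=> a x y; rewrite linearD /= -[a *: x]/(a * x) rmorphM. Qed.

Definition chi_module v : {linear B^o -> restr (chi v) (K^o^o)} :=
  mk_linear (@chi_module_linear v).

(** The characters are nonzero maps from the regular module to simple modules,
    so by faithfulness of [F] and [G] there is for each character a map from the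
    image of the regular module to the regular module of [B] on whose values the
    character does not vanish. Multiplying these maps on the right by the elements
    dual to the characters and adding them up gives one map with a value at which
    all characters are one; such a value is left invertible. *)
Lemma ex_unit_image : exists (h : {linear F A^o -> B^o}) m, h m = 1.
Proof.
(* h0 v lifts a map to the simple module at v through the regular module. *)
have /choice[h0 /choice[m0 hm0]] v : exists h : {linear F A^o -> B^o},
    exists m, chi v (h m) != 0.
  have [t t0] : exists t, fmap G (chi_module v) t != 0.
    apply: contrapT => /forallNP no_t.
    have : chi_module v =1 (\0 : B^o -> restr (chi v) (K^o^o)).
      apply: (fmapG_inj FG) => x; rewrite [RHS]fmap_eq0 //.
      by apply/eqP/negPn/negP; exact: no_t.
    move=> /(_ 1) /=; rewrite rmorph1 => /eqP; rewrite oner_eq0 //.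
  have [m hm] : exists m, adjunct eps (fmap G (chi_module v) t) m != 0.
    apply: contrapT => /forallNP no_m; case/eqP: t0.
    apply: (adjunct_eq0 FG) => y; apply/eqP/negPn/negP; exact: no_m.
  exists (adjunct eps t), m; move: hm; rewrite (adjunct_map FG).
  exact.
have hL : linear ((fun y => \sum_v (h0 v y : B) * e v) : F A^o -> B^o).
  move=> a x y; rewrite scaler_sumr -big_split; apply: eq_bigr => v _ /=.
  by rewrite linearP mulrDl scalerAl.
(* The scalar makes the v-th character of the image of m equal to one. *)
pose c v : B := (chi v (h0 v (m0 v)))^-1 *: e v.
pose m := \sum_v c v *: m0 v; pose h : {linear F A^o -> B^o} := mk_linear hL.
have hm1 v : chi v (h m) = 1.
  rewrite /= linear_sum (bigD1 v) //= rmorphM /= chi_idem eqxx mulr1.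
  rewrite [X in _ + X]big1 ?addr0; last first.
    by move=> w wv; rewrite rmorphM /= chi_idem (negbTE wv) mulr0.
  have hZ a y : h0 v (a *: y) = (a : B) * h0 v y by rewrite linearZ.
  have chi_c w : chi v (c w) = (chi w (h0 w (m0 w)))^-1 * (w == v)%:R.
    by rewrite /c linearZ /= chi_idem.
  rewrite /m !linear_sum (bigD1 v) //= hZ rmorphM /= chi_c eqxx mulr1 mulVf //.
  rewrite big1 ?addr0 // => w wv.
  by rewrite hZ rmorphM /= chi_c (negbTE wv) mulr0 mul0r.
have [w wu] := split_basic_linv chi_nil hm1.
by exists h, (w *: m); rewrite linearZ.
Qed.

End BasicQuotient.

Lemma linear_regular (R : pzRingType) (M : lmodType R) (h : {linear R^o -> M}) (b : R) :
  h b = b *: h 1.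
Proof. by rewrite -linearZ [_ *: _]mulr1. Qed.

(** By [ex_unit_image] the image of the regular module of [A] maps onto the
    regular module of [B], and, exchanging the roles, it is cyclic; as one-sided
    inverses in [B] are two-sided it is isomorphic to the regular module.
    Comparing endomorphism rings of regular modules, which are right
    multiplications, gives the isomorphism. *)
Lemma morita_basic_iso (K : fieldType) (A B : algType K) :
  split_basic A -> split_basic B -> morita_equivalent A B -> alg_iso A B.
Proof.
move=> [V [chiA [eA [chieA chinA]]]] [W [chiB [eB [chieB chinB]]]].
move=> [F [G [eta [eps FG]]]].
have {}FG : equivalence_data eta eps := FG.
have [eta' [eps' GF]] := equivalence_data_sym FG.
have [theta [m0 m01]] := ex_unit_image FG chieB chinB.
have [h' [n0 n01]] := ex_unit_image GF chieA chinA.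
have [etaB epsB etaN epsN] := FG.
have [z1 epsz1] : exists z, eps B^o z = 1.
  by have [g _ gK] := epsB B^o; exists (g 1).
pose y1 := fmap F h' z1.
have h'Z a y : h' (a *: y) = (a : A) * h' y by rewrite linearZ.
have epsZ b y : eps B^o (b *: y) = (b : B) * eps B^o y by rewrite linearZ.
(* The section of h' exists because the regular module is free on one element. *)
have genF y : exists b : B, y = b *: y1.
  pose s : {linear A^o -> G B^o} := orbit_map n0.
  have hs : idfun =1 h' \o s by move=> a /=; rewrite h'Z n01 mulr1.
  have yE : y = fmap F h' (fmap F s y).
    have := fmap_comp (m := F) hs y => /= <-; exact/esym/fmap_id.
  exists (eps B^o (fmap F s y)); rewrite {1}yE -linearZ; congr (fmap F h' _).
  by apply: (bij_inj (epsB B^o)); rewrite epsZ epsz1 mulr1.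
have thetaZ b y : theta (b *: y) = (b : B) * theta y by rewrite linearZ.
have [c cy1] : exists c : B, c * theta y1 = 1.
  by have [c m0E] := genF m0; exists c; rewrite -m01 m0E thetaZ.
have yc1 := split_basic_inv chinB cy1.
pose y0 := c *: y1; have ty0 : theta y0 = 1 by rewrite thetaZ.
have y0E y : y = (theta y : B) *: y0.
  have [b ->] := genF y.
  by rewrite thetaZ /y0 scalerA -mulrA yc1 mulr1.
pose rho (a : A) : {linear A^o -> A^o} := orbit_map (a : A^o).
have rhoE a x : rho a x = (x : A) * a by [].
pose Phi a : B := theta (fmap F (rho a) y0).
have PhiE a : fmap F (rho a) y0 = Phi a *: y0 by rewrite -y0E.
have PhiL : linear Phi.
  move=> k a a'; have := @fmap_linear _ _ _ F _ _ k (rho a) (rho a') (rho (k *: a + a')).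
  rewrite /Phi => ->; first by rewrite linearD thetaZ -scalerAl mul1r.
  move=> x; rewrite !rhoE mulrDr -scalerAr; congr (_ + _).
  by rewrite -[RHS]/(k%:A * ((x : A) * a)) -scalerAl mul1r.
have PhiM : multiplicative Phi.
  split=> [a a'|]; last first.
    rewrite /Phi (_ : fmap F (rho 1) y0 = y0) //; apply: fmap_id => x /=.
    exact: mulr1.
  have E : rho (a * a') =1 rho a' \o rho a.
    by move=> x /=; exact: mulrA.
  have -> : Phi (a * a') = theta (fmap F (rho a') (fmap F (rho a) y0)).
    by congr (theta _); exact: (fmap_comp (m := F) E y0).
  by rewrite PhiE [fmap F _ (_ *: _)]linearZ thetaZ.
exists (mk_lrmorphism PhiL PhiM).
have PhiI : injective Phi.
  move=> a a' aa'; apply/eqP; rewrite -subr_eq0; apply/eqP.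
  have Phi0 : Phi (a - a') = 0.
    rewrite addrC -scaleN1r; have := PhiL (-1) a' a; rewrite aa' => ->.
    by rewrite scaleN1r addNr.
  have : forall x, rho (a - a') x = 0.
    apply: (fmapF_inj FG) => y; rewrite (y0E y) linearZ PhiE Phi0 scale0r.
    exact: scaler0.
  by move=> /(_ 1) /=; rewrite scale1r.
(* Fullness: an endomorphism of the image is transported back along eta. *)
have PhiS b : exists a, Phi a = b.
  have uL : linear ((fun y => (theta y * b : B) *: y0) : F A^o -> F A^o).
    move=> k x y; rewrite linearP mulrDl scalerDl.
    by rewrite -[k *: theta x]/(k * theta x) -mulrA -scalerA.
  pose u : {linear F A^o -> F A^o} := mk_linear uL.
  have [g _ gK] := etaB A^o; pose a : A := g (fmap G u (eta A^o 1)).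
  exists a; have Fu : fmap F (rho a) =1 u.
    apply: (fmapG_inj FG) => w; rewrite -(gK w).
    have /= <- := etaN _ _ (rho a) (g w).
    have etaZ x y : eta A^o ((x : A) *: y) = x *: eta A^o y by rewrite linearZ.
    rewrite [LHS](etaZ (g w) a) {1}/a gK (linear_regular (eta A^o) (g w)).
    by rewrite [RHS]linearZ.
  by rewrite /Phi Fu /= ty0 mul1r thetaZ ty0 mulr1.
exists (fun b => sval (cid (PhiS b))) => [a|b] /=.
  by apply: PhiI; case: cid.
by case: cid.
Qed.

(** * Vertex characters and the radical *)

Section PathQuotient.
Variables (K : fieldType) (Q : quiver) (I : two_sided_ideal (path_alg K Q)).
Hypothesis adm : admissible I.

Lemma admissible_long2 : ideal_set I `<=` @long K Q 2.
Proof. by rewrite -arrow_exp_long; case: adm. Qed.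

(** The coefficient of a trivial path is well defined modulo an admissible ideal,
    since the ideal only involves paths of length at least two. *)
Definition vertex_char_fun v (x : quot_alg I) : K^o := (qrepr x)@_(triv_path v).

Lemma vertex_char_qpr v x : vertex_char_fun v (qpr I x) = x@_(triv_path v).
Proof.
apply/eqP; rewrite eq_sym -subr_eq0 -mcoeffB.
by rewrite (@admissible_long2 (x - _)) // qprE; exact: qreprP.
Qed.

Fact vertex_char_linear v : linear (vertex_char_fun v).
Proof.
move=> k x y; rewrite -(qreprE x) -(qreprE y) -(linearP (qpr I)) !vertex_char_qpr.
by rewrite mcoeffD pa_coefZ.
Qed.

Fact vertex_char_multiplicative v : multiplicative (vertex_char_fun v).
Proof.
split=> [x y|]; last by rewrite -(rmorph1 (qpr I)) vertex_char_qpr; exact: (@pa_one_coef K Q v).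
rewrite -(qreprE x) -(qreprE y) -(rmorphM (qpr I)) !vertex_char_qpr.
exact: (@pa_mul_coef K Q).
Qed.

Definition vertex_char v : {lrmorphism quot_alg I -> K^o} :=
  mk_lrmorphism (vertex_char_linear v) (vertex_char_multiplicative v).

Lemma longX x n : @long K Q 1 x -> long n (x ^+ n).
Proof.
move=> x1; elim: n => [|n IHn]; first by move=> p; rewrite ltn0.
by rewrite exprS; exact: (@longM K Q 1).
Qed.

Lemma vertex_char_eq0 x : (forall v, vertex_char v (qpr I x) = 0) -> long 1 x.
Proof.
move=> x0 p; rewrite ltnS leqn0 size_eq0 => /eqP p0.
have -> : p = triv_path (pstart p).
  by apply: val_inj; rewrite /= /pstart -p0; case: (qpval p).
by rewrite -vertex_char_qpr; exact: x0.
Qed.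

Lemma admissible_split_basic : split_basic (quot_alg I).
Proof.
exists (qvert Q), vertex_char, (fun v => qpr I (idem K v)); split=> [v w|x].
  rewrite /= vertex_char_qpr path_elt_coef; congr (_%:R); congr nat_of_bool.
  by apply/eqP/eqP => [[]|->].
have [[n _ nI] _] := adm; rewrite -(qreprE x) => /vertex_char_eq0 x0.
exists n; rewrite -(rmorphXn (qpr I)).
by apply/qpr_eq0/nI; rewrite arrow_exp_long; exact: longX.
Qed.

End PathQuotient.

(** The kernel of a character is a maximal left ideal. *)
Lemma jacobson_rad_char (K : fieldType) (A : algType K) (chi : {lrmorphism A -> K^o}) x :
  @jacobson_rad A x -> chi x = 0.
Proof.
move=> /(_ [set y | chi y = 0]); apply; split.
- split; first exact: rmorph0.
  + by move=> y z /= y0 z0; rewrite rmorphD /= y0 z0 addr0.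
  + by move=> a y /= y0; rewrite rmorphM /= y0 mulr0.
- apply/eqP => /seteqP[_ /(_ 1 I)] /=; rewrite rmorph1 => /eqP.
  by rewrite oner_eq0.
move=> J [J0 JD JM] chiJ.
have [JE|/existsNP[y /not_implyP[Jy y0]]] := pselect (J `<=` [set y | chi y = 0]).
  by left; apply/seteqP.
right; apply/seteqP; split=> // z _; have /eqP cy := y0.
have -> : z = (z - (chi z / chi y)%:A * y) + (chi z / chi y)%:A * y by rewrite subrK.
apply: (JD); last exact: JM.
have chiC (k : K) : chi k%:A = k by rewrite linearZ /= rmorph1 [_ *: _]mulr1.
apply: chiJ => /=; rewrite rmorphB rmorphM /= chiC.
by rewrite [_ * chi y]divfK // subrr.
Qed.

(** * Cycles in a symmetric multiserial algebra *)

(** A nontrivial central idempotent would split the algebra into the quotients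
    by the ideals it and its complement generate. *)
Lemma indecomposable_central_idem (K : fieldType) (B : algType K) (c : B) :
  indecomposable B -> c * c = c -> (forall x, c * x = x * c) -> c = 0 \/ c = 1.
Proof.
move=> indB cc cC; have [->|/eqP c0] := eqVneq c 0; first by left.
have [->|/eqP c1] := eqVneq c 1; first by right.
pose J1 : set B := [set x | x * c = x]; pose J2 : set B := [set x | x * c = 0].
have J1P : is_ideal J1.
  split; [split|] => /=; rewrite /J1 /=; first by rewrite mul0r.
  - by move=> x y; rewrite /= mulrDl => -> ->.
  - by move=> a x /= xc; rewrite -mulrA xc.
  - by move=> a x /= xc; rewrite -mulrA -cC mulrA xc.
have J2P : is_ideal J2.
  split; [split|] => /=; rewrite /J2 /=; first by rewrite mul0r.
  - by move=> x y; rewrite /= mulrDl => -> ->; rewrite addr0.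
  - by move=> a x /= xc; rewrite -mulrA xc mulr0.
  - by move=> a x /= xc; rewrite -mulrA -cC mulrA xc mul0r.
have J1_1 : ~ J1 1 by rewrite /J1 /= mul1r.
have J2_1 : ~ J2 1 by rewrite /J2 /= mul1r.
pose I1 := TwoSidedIdeal J1P J1_1; pose I2 := TwoSidedIdeal J2P J2_1.
pose f x : (quot_alg I1 * quot_alg I2)%type := (qpr I1 x, qpr I2 x).
have fL : linear f by move=> k x y; rewrite /f !linearP.
have fM : multiplicative f by split=> [x y|]; rewrite /f ?rmorphM ?rmorph1.
case: (indB (quot_alg I1) (quot_alg I2)); exists (mk_lrmorphism fL fM) => /=.
pose g (y : quot_alg I1 * quot_alg I2) : B := qrepr y.1 * (1 - c) + qrepr y.2 * c.
have e1 x y : qpr I1 (x * (1 - c) + y * c) = qpr I1 x.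
  apply/eqP; rewrite -subr_eq0 -rmorphB; apply/eqP/qpr_eq0 => /=; rewrite /J1 /=.
  have -> : x * (1 - c) + y * c - x = (y - x) * c.
    by rewrite mulrBr mulr1 addrAC [x - _ - x]addrAC subrr sub0r addrC mulrBl.
  by rewrite -mulrA cc.
have e2 x y : qpr I2 (x * (1 - c) + y * c) = qpr I2 y.
  apply/eqP; rewrite -subr_eq0 -rmorphB; apply/eqP/qpr_eq0 => /=; rewrite /J2 /=.
  have -> : x * (1 - c) + y * c - y = (x - y) * (1 - c).
    by rewrite mulrBl [y * (1 - c)]mulrBr mulr1 opprB addrA.
  by rewrite -mulrA [(1 - c) * c]mulrBl mul1r cc subrr mulr0.
have gK y : f (g y) = y.
  by case: y => y1 y2; rewrite /f /g e1 e2 !qreprE.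
have fI : injective f.
  move=> x y [/eqP xy1 /eqP xy2]; apply/eqP; rewrite -subr_eq0.
  move: xy1; rewrite -subr_eq0 -rmorphB => /eqP/qpr_eq0 /= xy1.
  move: xy2; rewrite -subr_eq0 -rmorphB => /eqP/qpr_eq0 /= xy2.
  by rewrite -[x - y]xy1 [_ * c]xy2.
by exists g => // x; apply: fI; rewrite gK.
Qed.

(** What the forward direction extracts from a symmetric multiserial algebra: the
    arrows are permuted by [nxt], the nonzero paths are the runs of this
    permutation up to length [len], and the longest ones span the socle, where
    the form decides proportionality. *)
Record cycle_structure (K : fieldType) (Q : quiver) (B : algType K)
    (x : qarrow Q -> B) (f : {scalar B})
    (nxt : qarrow Q -> qarrow Q) (len : qarrow Q -> nat) : Prop := CycleStructure {
  cs_tgt : forall a, tgt a = src (nxt a);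
  cs_len : forall a, len (nxt a) = len a;
  cs_iter : forall a, iter (len a) nxt a = a;
  cs_gt1 : forall a, (1 < len a)%N;
  cs_out : forall v, exists a : qarrow Q, src a == v;
  cs_turn : forall a b, b != nxt a -> x a * x b = 0;
  cs_long : forall a, \prod_(b <- traject nxt a (len a).+1) x b = 0;
  cs_form : forall a, f (\prod_(b <- traject nxt a (len a)) x b) != 0;
  cs_form_nxt : forall a, f (\prod_(b <- traject nxt (nxt a) (len (nxt a))) x b) =
    f (\prod_(b <- traject nxt a (len a)) x b);
  cs_line : forall a a', src a = src a' ->
    f (\prod_(b <- traject nxt a (len a)) x b) *: \prod_(b <- traject nxt a' (len a')) x b =
    f (\prod_(b <- traject nxt a' (len a')) x b) *: \prod_(b <- traject nxt a (len a)) x b }.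

Section SymmetricMultiserial.
Variables (K : fieldType) (Q : quiver) (B : algType K).
Variables (e : qvert Q -> B) (x : qarrow Q -> B) (f : {scalar B}).
Implicit Types (a b c : qarrow Q) (s t : seq (qarrow Q)) (u v w : qvert Q) (z : B).

Local Notation px s := (\prod_(a <- s) x a).

Hypothesis e_ortho : forall v w, e v * e w = (v == w)%:R *: e v.
Hypothesis e_neq0 : forall v, e v != 0.
Hypothesis src_x : forall a, e (src a) * x a = x a.
Hypothesis x_tgt : forall a, x a * e (tgt a) = x a.
Hypothesis x_neq0 : forall a, x a != 0.
Hypothesis x_minimal : forall a b z, x a = x b * z -> a = b.
Hypothesis span : forall P : B -> Prop,
  (forall y z, P y -> P z -> P (y + z)) -> (forall k z, P z -> P (k *: z)) ->
  (forall v s, P (e v * px s)) -> forall z, P z.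
Hypothesis nilp : exists N, forall s, (N <= size s)%N -> px s = 0.
Hypothesis serial_r : forall a b c, x a * x b != 0 -> x a * x c != 0 -> b = c.
Hypothesis f_comm : forall y z, f (y * z) = f (z * y).
Hypothesis f_ideal : forall J : set B, is_ideal J -> (forall z, J z -> f z = 0) ->
  J `<=` [set 0].
Hypothesis indec : indecomposable B.
Hypothesis rad2 : exists a b, x a * x b != 0.

Lemma e_idem v : e v * e v = e v.
Proof. by rewrite e_ortho eqxx scale1r. Qed.

Lemma e_x v a : e v * x a = (v == src a)%:R *: x a.
Proof. by rewrite -{1}(src_x a) mulrA e_ortho -scalerAl; case: eqP => [->|]; rewrite ?scale0r // src_x. Qed.

Lemma x_e v a : x a * e v = (tgt a == v)%:R *: x a.
Proof. by rewrite -{1}(x_tgt a) -mulrA e_ortho -scalerAr x_tgt. Qed.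

Lemma x_compos a b : x a * x b != 0 -> tgt a = src b.
Proof.
apply: contraNeq => ab; rewrite -(x_tgt a) -mulrA e_x (negbTE ab).
by rewrite scale0r mulr0.
Qed.

(** Only annihilation by arrows from the right is asked for; [soc_left] gives the
    other side. *)
Definition in_soc z := forall b, z * x b = 0.

Lemma in_soc_px z v s : in_soc z -> s != [::] -> z * (e v * px s) = 0.
Proof.
case: s => // b s zs _; rewrite big_cons (mulrA (e v)) e_x -scalerAl -scalerAr.
by rewrite mulrA zs mul0r scaler0.
Qed.

(** For a symmetric form, the one-sided radical is a two-sided ideal in the
    kernel. *)
Lemma f_nondeg z : (forall y, f (z * y) = 0) -> z = 0.
Proof.
move=> z0; apply: (f_ideal (J := [set z | forall y, f (z * y) = 0])) => //=.
  split; first split=> /=.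
  - by move=> y; rewrite mul0r linear0.
  - by move=> y y' /= y0 y'0 t; rewrite mulrDl linearD /= y0 y'0 addr0.
  - by move=> a y /= y0 t; rewrite f_comm mulrA f_comm y0.
  - by move=> a y /= y0 t; rewrite -mulrA.
by move=> y /= /(_ 1); rewrite mulr1.
Qed.

Lemma f_corner v w z : e v * z = z -> z * e w = z -> v != w -> f z = 0.
Proof.
move=> vz zw vw; rewrite -zw f_comm -{1}vz mulrA e_ortho eq_sym (negbTE vw).
by rewrite scale0r mul0r linear0.
Qed.

(** On the right ideal generated by such a [z] the form only sees the multiples
    of [z] itself. *)
Lemma soc_eq0 z v : in_soc z -> e v * z = z -> f z = 0 -> z = 0.
Proof.
move=> zs vz fz; apply: f_nondeg; apply: span => [y y'|k y|u s].
- by rewrite mulrDr linearD /= => -> ->; rewrite addr0.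
- by rewrite -scalerAr linearZ /= => ->; rewrite mulr0.
have [->|s0] := eqVneq s [::]; last by rewrite in_soc_px // linear0.
rewrite big_nil mulr1; have [->|uv] := eqVneq u v; first by rewrite f_comm vz.
by rewrite f_comm -vz mulrA e_ortho (negbTE uv) scale0r mul0r linear0.
Qed.

Lemma soc_left z b : in_soc z -> x b * z = 0.
Proof.
move=> zs; apply: f_nondeg => y; rewrite -mulrA f_comm; move: y.
apply: span => [y y'|k y|u s].
- by rewrite mulrDr mulrDl linearD /= => -> ->; rewrite addr0.
- by rewrite -scalerAr -scalerAl linearZ /= => ->; rewrite mulr0.
have -> : z * (e u * px s) * x b = z * (e u * px (rcons s b)).
  by rewrite -cats1 big_cat /= big_seq1 !mulrA.
by rewrite in_soc_px ?linear0 // -size_eq0 size_rcons.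
Qed.

(** A symmetric form vanishes on elements from one vertex to a different one. *)
Lemma soc_closed z v w :
  in_soc z -> e v * z = z -> z * e w = z -> z != 0 -> v = w.
Proof.
move=> zs vz zw; apply: contraNeq => vw; apply/eqP.
exact: (soc_eq0 zs vz (f_corner vz zw vw)).
Qed.

(** The socle at a vertex is one-dimensional: the difference of the two sides is a
    socle element in the kernel of the form. *)
Lemma soc_line z z' v : in_soc z -> e v * z = z -> in_soc z' -> e v * z' = z' ->
  f z *: z' = f z' *: z.
Proof.
move=> zs vz zs' vz'; apply/eqP; rewrite -subr_eq0; apply/eqP.
apply: (@soc_eq0 _ v).
- by move=> b; rewrite mulrBl -!scalerAl zs zs' !scaler0 subrr.
- by rewrite mulrBr -!scalerAr vz vz'.
- by rewrite linearB /= !linearZ /= mulrC subrr.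
Qed.

Lemma soc_extend z : z != 0 -> exists s, z * px s != 0 /\ in_soc (z * px s).
Proof.
move=> z0; have [N nilN] := nilp.
pose P n := `[< exists2 s, size s = n & z * px s != 0 >].
have exP : exists n, P n.
  by exists 0%N; apply/asboolP; exists [::]; rewrite // big_nil mulr1.
have ubP n : P n -> (n <= N)%N.
  move=> /asboolP[s sn]; rewrite leqNgt; apply: contraNN => Nn.
  by rewrite nilN ?mulr0 // sn ltnW.
case: (ex_maxnP exP ubP) => n /asboolP[s sn zs] maxn.
exists s; split=> // b; apply/eqP; apply: contraT => zsb.
have /maxn : P n.+1.
  apply/asboolP; exists (rcons s b); first by rewrite size_rcons sn.
  by rewrite -cats1 big_cat /= big_seq1 mulrA.
by rewrite ltnn.
Qed.

(** The shape of a vertex that splits off: all arrows touching it are loops in the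
    socle. The algebra would then be the field or a square-zero extension of it,
    which the assumption on products of arrows excludes. *)
Definition isolated v := forall b, src b = v \/ tgt b = v ->
  [/\ src b = v, tgt b = v & in_soc (x b)].

Lemma not_isolated v : ~ isolated v.
Proof.
move=> iv; have cx b : GRing.comm (e v) (x b).
  rewrite /GRing.comm e_x x_e.
  have [vb|vb] := eqVneq v (src b).
    by have [_ -> _] := iv b (or_introl (esym vb)); rewrite eqxx.
  have [bv|//] := eqVneq (tgt b) v.
  by have [sv _ _] := iv b (or_intror bv); rewrite sv eqxx in vb.
(* The idempotent of an isolated vertex commutes with all arrows, so it is central. *)
have c_ev y : e v * y = y * e v.
  move: y; apply: span => [y y'|k y|u s].
  - by rewrite mulrDr mulrDl => -> ->.
  - by rewrite -scalerAr -scalerAl => ->.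
  apply: commrM; last by apply: commr_prod => b _; exact: cx.
  by rewrite /GRing.comm !e_ortho; case: eqVneq => [->|]; rewrite ?eqxx // !scale0r.
have [v0|v1] := indecomposable_central_idem indec (e_idem v) c_ev.
  by have := e_neq0 v; rewrite v0 eqxx.
have all_v w : w = v.
  apply/eqP; apply: contraT => wv; have := e_neq0 w.
  by rewrite -(mulr1 (e w)) -v1 e_ortho (negbTE wv) scale0r eqxx.
have [a [b]] := rad2; have [_ _ ->] := iv a (or_introl (all_v _)).
by rewrite eqxx.
Qed.

Lemma no_out_isolated v : (forall a, src a <> v) -> isolated v.
Proof.
move=> nv b [/nv//|bv].
have xb : in_soc (x b).
  move=> c; apply/eqP; apply: contraT => /x_compos bc.
  by case: (nv c); rewrite -bc.
have := soc_closed xb (src_x b) (x_tgt b) (x_neq0 b); rewrite bv => sb.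
by case: (nv b).
Qed.

(** A socle arrow is a loop. Another arrow at its start would extend to a path in
    the same one-dimensional socle, making the loop a multiple of a longer path,
    against minimality of the arrows; and an arrow ending there has no
    continuation, since the loop is annihilated from the left as well. *)
Lemma soc_arrow_isolated a : in_soc (x a) -> isolated (src a).
Proof.
move=> xa; have st := soc_closed xa (src_x a) (x_tgt a) (x_neq0 a).
have out b : src b = src a -> b = a.
  move=> ba; have [s [zs0 zs]] := soc_extend (x_neq0 b).
  have vz : e (src a) * (x b * px s) = x b * px s by rewrite mulrA -ba src_x.
  have fz : f (x b * px s) != 0.
    by apply: contraNN zs0 => /eqP fz; apply/eqP; exact: soc_eq0 zs vz fz.
  apply/esym/(@x_minimal _ _ ((f (x b * px s))^-1 * f (x a) *: px s)).
  rewrite -scalerAr -scalerA (soc_line xa (src_x a) zs vz) scalerA mulVf //.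
  by rewrite scale1r.
move=> b [/out->|tb]; first by rewrite -st.
have xb : in_soc (x b).
  move=> c; apply/eqP; apply: contraT => bc.
  have ca : c = a by apply: out; rewrite -(x_compos bc).
  by rewrite ca soc_left ?eqxx in bc.
have := soc_closed xb (src_x b) (x_tgt b) (x_neq0 b).
by rewrite tb.
Qed.

Lemma out_exists v : exists a, src a == v.
Proof.
apply: contrapT => /forallNP nv; apply: (@not_isolated v).
by apply: no_out_isolated => a av; apply: (nv a); rewrite av.
Qed.

Lemma succ_exists a : exists b, x a * x b != 0.
Proof.
apply: contrapT => /forallNP na; apply: (@not_isolated (src a)).
by apply: soc_arrow_isolated => b; apply/eqP/negPn/negP; exact: na.
Qed.

Definition succ a : qarrow Q := xchoose (succ_exists a).
Local Notation run := (traject succ).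

Lemma succP a : x a * x (succ a) != 0.
Proof. exact: (xchooseP (succ_exists a)). Qed.

Lemma succE a b : (x a * x b != 0) = (b == succ a).
Proof.
apply/idP/eqP => [ab|->]; last exact: succP.
exact: serial_r ab (succP a).
Qed.

Lemma tgt_succ a : tgt a = src (succ a).
Proof. exact: x_compos (succP a). Qed.

Lemma run_bound a : exists N, forall n, px (run a n) != 0 -> (n <= N)%N.
Proof.
have [N nilN] := nilp; exists N => n; rewrite leqNgt; apply: contraNN => Nn.
by rewrite nilN // size_traject ltnW.
Qed.

Lemma cycle_len_exists a : exists n, px (run a n.+1) != 0 /\
  forall m, px (run a m) != 0 -> (m <= n.+1)%N.
Proof.
have [N ub] := run_bound a.
have exP : exists n, px (run a n) != 0.
  by exists 1%N; rewrite /= big_seq1 x_neq0.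
case: (ex_maxnP exP ub) => -[|n] Pn maxn; last by exists n.
by have := maxn 1%N; rewrite /= big_seq1 => /(_ (x_neq0 a)).
Qed.

Definition cycle_len a : nat := (sval (cid (cycle_len_exists a))).+1.

Lemma cycle_neq0 a : px (run a (cycle_len a)) != 0.
Proof. by rewrite /cycle_len; case: cid => n []. Qed.

Lemma cycle_len_max a n : px (run a n) != 0 -> (n <= cycle_len a)%N.
Proof. by rewrite /cycle_len; case: cid => m [_ maxm] /=; exact: maxm. Qed.

Lemma cycle_len_gt1 a : (1 < cycle_len a)%N.
Proof. by apply: cycle_len_max; rewrite /= big_cons big_seq1 succP. Qed.

Lemma run_long a : px (run a (cycle_len a).+1) = 0.
Proof. by apply/eqP; apply: contraT => /cycle_len_max; rewrite ltnn. Qed.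

Lemma px_runSr a n : px (run a n.+1) = px (run a n) * x (iter n succ a).
Proof. by rewrite trajectSr -cats1 big_cat /= big_seq1. Qed.

Lemma cycle_soc a : in_soc (px (run a (cycle_len a))).
Proof.
move=> b; have [->|b_neq] := eqVneq b (iter (cycle_len a) succ a).
  by rewrite -px_runSr run_long.
rewrite -(prednK (ltnW (cycle_len_gt1 a))) px_runSr -mulrA.
move: b_neq; rewrite -{1}(prednK (ltnW (cycle_len_gt1 a))) iterS -succE negbK.
by move=> /eqP->; rewrite mulr0.
Qed.

Lemma src_run a n : (0 < n)%N -> e (src a) * px (run a n) = px (run a n).
Proof. by case: n => // n _; rewrite /= big_cons mulrA src_x. Qed.

Lemma f_cycle a : f (px (run a (cycle_len a))) != 0.
Proof.
apply: contraNN (cycle_neq0 a) => /eqP f0; apply/eqP.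
exact: soc_eq0 (@cycle_soc a) (src_run a (ltnW (cycle_len_gt1 a))) f0.
Qed.

Lemma cycle_rot a : px (run a (cycle_len a)) = x a * px (run (succ a) (cycle_len a).-1).
Proof. by rewrite -{1}(prednK (ltnW (cycle_len_gt1 a))) /= big_cons. Qed.

(** The form is nonzero on the longest path from [a], hence on its rotation, so
    the last arrow of that path can be followed by [a]. *)
Lemma iter_cycle_len a : iter (cycle_len a) succ a = a.
Proof.
have := f_cycle a; rewrite cycle_rot f_comm.
have := cycle_len_gt1 a; case: (cycle_len a) => [|[|n]] //= _ fn.
apply/esym/eqP; rewrite -iterS iterSr -succE.
apply: contraNN fn => /eqP xx0; rewrite -[X in f (X * _)]/(px (run (succ a) n.+1)).
by rewrite px_runSr -mulrA xx0 mulr0 linear0.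
Qed.

Lemma run_succ a :
  px (run (succ a) (cycle_len a)) = px (run (succ a) (cycle_len a).-1) * x a.
Proof.
have l_gt0 := ltnW (cycle_len_gt1 a).
by rewrite -{1}(prednK l_gt0) px_runSr -iterSr prednK // iter_cycle_len.
Qed.

Lemma f_run_succ a :
  f (px (run (succ a) (cycle_len a))) = f (px (run a (cycle_len a))).
Proof. by rewrite run_succ cycle_rot f_comm. Qed.

(** Rotation shows that lengths can only grow along the permutation, and the
    permutation returns to [a]. *)
Lemma cycle_len_succ a : cycle_len (succ a) = cycle_len a.
Proof.
have le_succ b : (cycle_len b <= cycle_len (succ b))%N.
  apply: cycle_len_max; apply: contraNN (f_cycle b) => /eqP b0.
  by rewrite -f_run_succ b0 linear0.
have le_iter n b : (cycle_len b <= cycle_len (iter n succ b))%N.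
  by elim: n => //= n IHn; apply: leq_trans IHn (le_succ _).
apply/eqP; rewrite eqn_leq le_succ andbT.
rewrite -{2}(iter_cycle_len a) -(prednK (ltnW (cycle_len_gt1 a))) iterSr.
exact: le_iter.
Qed.

Lemma f_cycle_succ a : f (px (run (succ a) (cycle_len (succ a)))) =
  f (px (run a (cycle_len a))).
Proof. by rewrite cycle_len_succ f_run_succ. Qed.

Lemma symmetric_cycle_structure : cycle_structure x f succ cycle_len.
Proof.
split.
- exact: tgt_succ.
- exact: cycle_len_succ.
- exact: iter_cycle_len.
- exact: cycle_len_gt1.
- exact: out_exists.
- by move=> a b; rewrite -succE negbK => /eqP.
- exact: run_long.
- exact: f_cycle.
- exact: f_cycle_succ.
- move=> a b ab; apply: (@soc_line _ _ (src a)).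
  + exact: cycle_soc.
  + exact/src_run/ltnW/cycle_len_gt1.
  + exact: cycle_soc.
  + by rewrite ab; exact/src_run/ltnW/cycle_len_gt1.
Qed.

End SymmetricMultiserial.

(** * Rescaling the arrows along the cycles *)

Section CyclePowers.
Variables (T : finType) (nxt : T -> T) (len : T -> nat).
Hypothesis len_nxt : forall a, len (nxt a) = len a.
Hypothesis iter_len : forall a, iter (len a) nxt a = a.
Hypothesis len_gt0 : forall a, (0 < len a)%N.
Hypothesis nxt_inj : injective nxt.

(** The quotient of the two is the multiplicity of the cycle. *)
Lemma order_dvd_len a : (order nxt a %| len a)%N.
Proof.
have iter_mul k : iter (k * order nxt a) nxt a = a.
  by elim: k => // k IHk; rewrite mulSn iterD IHk iter_order.
have ord_gt0 := order_gt0 nxt a.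
have : iter (len a %% order nxt a) nxt a = a.
  have := iter_len a; rewrite {1}(divn_eq (len a) (order nxt a)) addnC iterD.
  by rewrite iter_mul.
move/(congr1 (findex nxt a)); rewrite findex_iter ?ltn_pmod // findex0 => /eqP.
by rewrite /dvdn.
Qed.

Lemma fconnect_invariant (R : Type) (g : T -> R) a b :
  (forall c, g (nxt c) = g c) -> fconnect nxt a b -> g b = g a.
Proof. by move=> gn /iter_findex <-; elim: findex => //= n <-. Qed.

Lemma traject_mul a k :
  traject nxt a (k * order nxt a) = flatten (nseq k (orbit nxt a)).
Proof.
by elim: k => //= k <-; rewrite mulSn trajectD iter_order.
Qed.

(** It suffices to rescale a single arrow on each cycle; a cycle of multiplicity m
    passes it m times, so the factor is an m-th root, which exists because the
    field is algebraically closed. *)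
Lemma cycle_normalization (K : closedFieldType) (t : T -> K) :
  (forall a, t a != 0) -> (forall a, t (nxt a) = t a) ->
  exists lam : T -> K, (forall a, lam a != 0) /\
    forall a, \prod_(b <- traject nxt a (len a)) lam b = (t a)^-1.
Proof.
move=> t_neq0 t_nxt.
have /choice[c cP] a : exists c : K, c ^+ (len a %/ order nxt a) = (t a)^-1.
  have n_gt0 : (0 < len a %/ order nxt a)%N.
    by rewrite divn_gt0 ?order_gt0 // dvdn_leq // order_dvd_len.
  have [c] := @solve_monicpoly K _ (fun i => (t a)^-1 *+ (i == 0%N)) n_gt0.
  move=> cE; exists c; rewrite cE (bigD1 (Ordinal n_gt0)) //= expr0 mulr1 mulr1n.
  rewrite big1 ?addr0 // => i i0; rewrite (_ : (i == 0%N :> nat) = false) ?mul0r //.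
  by apply/negbTE; apply: contra i0 => /eqP i0; apply/eqP/val_inj.
exists (fun a => if a == froot nxt a then c a else 1); split=> a.
  case: ifP => _; last exact: oner_neq0.
  have n_gt0 : (0 < len a %/ order nxt a)%N.
    by rewrite divn_gt0 ?order_gt0 // dvdn_leq // order_dvd_len.
  have : (c a ^+ (len a %/ order nxt a)) != 0 by rewrite cP invr_eq0.
  by rewrite expf_eq0 n_gt0.
have sym := fconnect_sym nxt_inj; set r := froot nxt a.
have ar : fconnect nxt a r := connect_root _ a.
have len_r : len r = len a := fconnect_invariant len_nxt ar.
have t_r : t r = t a := fconnect_invariant t_nxt ar.
have ord_r : order nxt r = order nxt a.
  by apply: eq_card => b; rewrite !inE (same_connect sym ar).
have orb : \prod_(b <- orbit nxt a) (if b == froot nxt b then c b else 1) = c r.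
  rewrite (bigD1_seq r) ?orbit_uniq //=; last by rewrite -fconnect_orbit.
  rewrite root_root // eqxx big1_seq ?mulr1 // => b /andP[br].
  rewrite -fconnect_orbit => ab; case: eqP => // bb; case/eqP: br.
  rewrite bb /r; apply/eqP; rewrite root_connect // sym //.
rewrite -{1}(divnK (order_dvd_len a)) traject_mul.
have -> : \prod_(b <- flatten (nseq (len a %/ order nxt a) (orbit nxt a)))
    (if b == froot nxt b then c b else 1) = c r ^+ (len a %/ order nxt a).
  by elim: (_ %/ _)%N => [|k IHk]; rewrite ?big_nil //= big_cat IHk exprS orb.
by rewrite -len_r -ord_r cP t_r.
Qed.

End CyclePowers.

(** * The configuration of a permutation of arrows *)

Lemma sum_count_mem (T : finType) (s : seq T) : (\sum_(y : T) count_mem y s = size s)%N.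
Proof.
elim: s => [|a s IHs] /=; first by rewrite big1.
rewrite big_split /= IHs (bigD1 a) //= eqxx big1 // => y /negbTE ya.
by rewrite eq_sym ya.
Qed.

Section OrbitConfig.
Variables (Q : quiver) (nxt : qarrow Q -> qarrow Q) (len : qarrow Q -> nat).
Hypothesis tgt_nxt : forall a, tgt a = src (nxt a).
Hypothesis len_nxt : forall a, len (nxt a) = len a.
Hypothesis iter_len : forall a, iter (len a) nxt a = a.
Hypothesis len_gt1 : forall a, (1 < len a)%N.
Hypothesis out_exists : forall v, exists a : qarrow Q, src a == v.

Local Notation nxt_inj := (nxt_inj len_nxt iter_len len_gt1).
Local Notation len_gt0 := (len_gt0 len_gt1).

Definition arrows_from (v : qvert Q) : {set qarrow Q} := [set a | src a == v].

(** One vertex for each cycle of arrows, and a truncated vertex for each quiver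
    vertex with a single outgoing arrow, whose polygon would otherwise have only
    one vertex. *)
Definition cvert : finType :=
  ({r : qarrow Q | froots nxt r} + {v : qvert Q | #|arrows_from v| == 1%N})%type.

Definition orbit_vert (a : qarrow Q) : cvert :=
  inl (exist _ (froot nxt a) (roots_root (fconnect_sym nxt_inj) a)).

Definition cpoly (v : qvert Q) : seq cvert :=
  [seq orbit_vert a | a <- enum (arrows_from v)] ++
  [seq inr u | u <- enum {: {v : qvert Q | #|arrows_from v| == 1%N}} & val u == v].

Definition cmult (y : cvert) : nat :=
  if y is inl r then (len (val r) %/ order nxt (val r))%N else 1%N.

Definition corient (y : cvert) : seq (qvert Q) :=
  match y with inl r => map (@src Q) (orbit nxt (val r)) | inr u => [:: val u] end.

Lemma corient_count y v : count_mem v (corient y) = count_mem y (cpoly v).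
Proof.
rewrite /cpoly count_cat !count_map; case: y => [r|u] /=.
  rewrite [X in (_ + X)%N](eq_count (a2 := pred0)) // count_pred0 addn0.
  rewrite count_map -!size_filter; apply/perm_size/uniq_perm.
  - by rewrite filter_uniq // orbit_uniq.
  - by rewrite filter_uniq // enum_uniq.
  move=> b; rewrite mem_filter [RHS]mem_filter mem_enum inE [RHS]andbC; congr andb => /=; first by rewrite inE.
  rewrite -fconnect_orbit.
  have sym := fconnect_sym nxt_inj.
  rewrite -(root_connect sym) (eqP (valP r)) eq_sym.
  apply/eqP/eqP => [br|[/(congr1 val)//]].
  by rewrite /orbit_vert; congr inl; apply: val_inj.
rewrite addn0 [X in _ = (X + _)%N](eq_count (a2 := pred0)) // count_pred0 add0n.
rewrite count_filter.
have [uv|uv] := eqVneq (val u) v.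
  rewrite -[RHS](@eq_count _ (pred1 u)) => [|w] /=.
    by rewrite count_uniq_mem ?enum_uniq // mem_enum.
  by case: eqVneq => [->|wu] /=; [rewrite uv !eqxx | apply/esym/andP => -[/eqP[wu']]; rewrite wu' eqxx in wu].
rewrite (@eq_count _ _ pred0) ?count_pred0 // => w /=.
by apply/andP => -[/eqP[->]]; rewrite (negbTE uv).
Qed.

Definition cdata : brauer_data := BrauerData (fun v => seq_mset (cpoly v)) cmult.

Lemma cvalE y : bval (G := cdata) y = size (corient y).
Proof.
rewrite -sum_count_mem; apply: eq_bigr => v _.
by rewrite /= mset_seqE corient_count.
Qed.

Lemma cval_inl r : bval (G := cdata) (inl r) = order nxt (val r).
Proof. by rewrite cvalE /= size_map size_orbit. Qed.

Lemma clen r : (bval (G := cdata) (inl r) * cmult (inl r))%N = len (val r).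
Proof.
by rewrite cval_inl /= mulnC divnK //; exact: (order_dvd_len iter_len nxt_inj).
Qed.

Lemma ctruncated y : truncated (G := cdata) y = if y is inl _ then false else true.
Proof.
case: y => [r|u]; first by rewrite /truncated clen gtn_eqF.
by rewrite /truncated cvalE.
Qed.

Lemma size_cpoly v :
  size (cpoly v) = (#|arrows_from v| + (#|arrows_from v| == 1))%N.
Proof.
rewrite size_cat !size_map -cardE; congr (_ + _)%N.
have [v1|v1] := boolP (#|arrows_from v| == 1%N).
  have -> : [seq u <- enum {: {v : qvert Q | #|arrows_from v| == 1%N}} | val u == v]
     = [seq u <- enum {: {v : qvert Q | #|arrows_from v| == 1%N}} |
         pred1 (exist _ v v1) u] by apply: eq_filter => u; rewrite /= -val_eqE.
  by rewrite size_filter count_uniq_mem ?enum_uniq // mem_enum.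
rewrite size_filter; apply/eqP; rewrite -leqn0 leqNgt -has_count.
apply/hasP => -[u _ /eqP uv]; move: (valP u); rewrite uv /=.
exact/negP.
Qed.

Lemma card_arrows_gt0 v : (0 < #|arrows_from v|)%N.
Proof. by have [a av] := out_exists v; apply/card_gt0P; exists a; rewrite inE. Qed.

Lemma size_seq_mset (T : choiceType) (s : seq T) : size (seq_mset s) = size s.
Proof. exact/perm_size/perm_eq_seq_mset. Qed.

Lemma in_seq_mset (T : choiceType) (s : seq T) x : (x \in seq_mset s) = (x \in s).
Proof. by rewrite in_mset mset_seqE -has_count has_pred1. Qed.

Lemma cmult_gt0 y : (0 < cmult y)%N.
Proof.
case: y => [r|//] /=; rewrite divn_gt0 ?order_gt0 // dvdn_leq ?len_gt0 //.
exact: (order_dvd_len iter_len nxt_inj).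
Qed.

Definition orbit_config : brauer_config.
Proof.
refine (@BrauerConfig cdata
  (fun y => Tuple (introT eqP (esym (cvalE y)))) cmult_gt0 _ (qvert_gt0 Q) _ _ _ _).
- by move=> y v; rewrite /= mset_seqE corient_count.
- move=> y; have : (0 < bval (G := cdata) y)%N.
    by rewrite cvalE; case: y => //= r; rewrite size_map size_orbit order_gt0.
  rewrite lt0n sum_nat_eq0 negb_forall => /existsP[v]; rewrite /= mset_seqE => yv.
  by exists v; rewrite /= in_mset mset_seqE lt0n.
- move=> v; rewrite /= size_seq_mset size_cpoly.
  by case: #|_| (card_arrows_gt0 v) => [|[]].
- move=> v; have [a av] := out_exists v; exists (orbit_vert a); last first.
    by rewrite clen.
  by rewrite /= in_seq_mset mem_cat map_f // mem_enum inE.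
- move=> y v; rewrite ctruncated; case: y => // u _ /=.
  rewrite in_seq_mset mem_cat => /orP[/mapP[]//|/mapP[u']].
  rewrite mem_filter => /andP[/eqP <- _] _; rewrite size_seq_mset size_cpoly.
  by rewrite (eqP (valP u')).
Defined.

Local Notation BQ := (brauer_quiver orbit_config).

(** Truncated vertices carry no arrow, so the second value is arbitrary. *)
Definition amap_fun (y : cvert) (i : nat) : qarrow Q :=
  match y with
  | inl r => iter i nxt (val r)
  | inr u => xchoose (out_exists (val u))
  end.

Definition amap (a : qarrow BQ) : qarrow Q := amap_fun (tag (val a)) (tagged (val a)).

Lemma barrow_ind (P : qarrow BQ -> Prop) :
  (forall (r : {r | froots nxt r}) (nr : ~~ truncated (G := orbit_config) (inl r)) i,
     P (barrow nr i)) -> forall a, P a.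
Proof.
move=> Pr a; rewrite (barrowK a); case: a => -[[r|u] i] na /=; first exact: Pr.
by have := ctruncated (inr u); rewrite [truncated _](negbTE na).
Qed.

Lemma src_amap a : src (amap a) = src a.
Proof.
elim/barrow_ind: a => r nr i; rewrite /amap /= /barrow_src /=.
have lt_i : (i < order nxt (val r))%N by have := ltn_ord i; rewrite {2}cval_inl.
by rewrite (tnth_nth (src (val r))) /= (nth_map (val r)) ?size_orbit // nth_traject.
Qed.

Lemma amap_next a : amap (bnext a) = nxt (amap a).
Proof.
elim/barrow_ind: a => r nr i; rewrite bnext_barrow /amap /=.
have ord_i := ltn_ord i; rewrite [X in (_ < X)%N](cval_inl r) in ord_i.
rewrite -iterS [X in (_ %% X)%N](cval_inl r).
have [lt_i|le_i] := ltnP i.+1 (order nxt (val r)); first by rewrite modn_small.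
have -> : i.+1 = order nxt (val r) by apply/eqP; rewrite eqn_leq le_i ord_i.
by rewrite modnn (iter_order nxt_inj).
Qed.

Lemma amap_len a : len (amap a) = blen a.
Proof.
elim/barrow_ind: a => r nr i; rewrite /amap [RHS]clen /=.
exact: len_iter.
Qed.

Lemma amap_inj : injective amap.
Proof.
elim/barrow_ind => r nr i; elim/barrow_ind => r' nr' i'; rewrite /amap /= => ii.
have sym := fconnect_sym nxt_inj.
have rr : r = r'.
  apply: val_inj; rewrite -(eqP (valP r)) -(eqP (valP r')) /=.
  apply/eqP; rewrite (root_connect sym).
  apply: connect_trans (fconnect_iter _ i _) _; rewrite ii sym; exact: fconnect_iter.
subst r'; apply: val_inj; congr existT; apply: ord_inj.
have lt_i (j : 'I_(bval (G := cdata) (inl r))) : (j < order nxt (val r))%N.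
  by rewrite -cval_inl.
by rewrite -(findex_iter (lt_i i)) ii findex_iter.
Qed.

(** With [amap_inj], [src_amap], [amap_next] and [amap_len]: the quiver of the
    configuration is the given quiver, with the same permutation and lengths. *)
Lemma amap_surj b : exists a, amap a = b.
Proof.
set r : {r | froots nxt r} := exist _ (froot nxt b) (roots_root (fconnect_sym nxt_inj) b).
have nr : ~~ truncated (G := orbit_config) (inl r) by rewrite [truncated _]ctruncated.
have rb : fconnect nxt (val r) b by rewrite (fconnect_sym nxt_inj) connect_root.
have lt_i : (findex nxt (val r) b < bval (G := cdata) (inl r))%N.
  by rewrite cval_inl findex_max.
by exists (barrow nr (Ordinal lt_i)); rewrite /amap /= iter_findex.
Qed.

Lemma amap_run a n : [seq amap b | b <- traject (@bnext orbit_config) a n] =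
  traject nxt (amap a) n.
Proof. by elim: n a => //= n IHn a; rewrite IHn amap_next. Qed.

End OrbitConfig.

(** * Presentation by the configuration, and the theorem *)

Lemma prod_scale (K : fieldType) (B : algType K) (I : Type) (lam : I -> K)
    (x : I -> B) (s : seq I) :
  \prod_(a <- s) (lam a *: x a) = (\prod_(a <- s) lam a) *: \prod_(a <- s) x a.
Proof.
elim: s => [|a s IHs]; first by rewrite !big_nil scale1r.
by rewrite !big_cons IHs -scalerAl -scalerAr scalerA.
Qed.

Section BrauerPresentation.
Variables (K : closedFieldType) (Q : quiver) (B : algType K).
Variables (e : qvert Q -> B) (x : qarrow Q -> B) (f : {scalar B}).
Variables (nxt : qarrow Q -> qarrow Q) (len : qarrow Q -> nat).
Hypothesis e_ortho : forall v w, e v * e w = (v == w)%:R *: e v.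
Hypothesis e_sum : \sum_v e v = 1.
Hypothesis src_x : forall a, e (src a) * x a = x a.
Hypothesis x_tgt : forall a, x a * e (tgt a) = x a.
Hypothesis span : forall P : B -> Prop,
  (forall y z, P y -> P z -> P (y + z)) -> (forall k z, P z -> P (k *: z)) ->
  (forall v s, P (e v * \prod_(a <- s) x a)) -> forall z, P z.
Hypothesis cs : cycle_structure x f nxt len.

(** The rescaled arrows define a morphism from the path algebra of the
    configuration. Its kernel contains the relations and no socle path, so it is
    the radical of the cycle form, by the two inclusions proved for ideals of
    that kind. *)
Lemma brauer_presentation : exists G, alg_iso B (brauer_alg K G).
Proof.
have [tgt_nxt len_nxt iter_len len_gt1 out_ex turn0 long0 fne0 fnxt line] := cs.
have nI : injective nxt by exact: (nxt_inj len_nxt iter_len len_gt1).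
have [lam [lam0 lamP]] := cycle_normalization len_nxt iter_len (len_gt0 len_gt1) nI fne0 fnxt.
pose G := orbit_config len_nxt iter_len len_gt1 out_ex.
pose am : qarrow (brauer_quiver G) -> qarrow Q := @amap _ _ _ len_nxt iter_len len_gt1 out_ex.
have src_am a : src (am a) = src a by exact: src_amap.
have am_next a : am (bnext a) = nxt (am a) by exact: amap_next.
have tgt_am a : tgt (am a) = tgt a by rewrite tgt_nxt -am_next src_am tgt_bnext.
pose y a : B := lam (am a) *: x (am a).
have src_y (a : qarrow (brauer_quiver G)) : e (src a) * y a = y a by rewrite /y -scalerAr -src_am src_x.
have y_tgt (a : qarrow (brauer_quiver G)) : y a * e (tgt a) = y a by rewrite /y -scalerAl -tgt_am x_tgt.
(* The vertices of the quiver of G are by definition those of Q. *)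
pose p := path_morphism (Q := brauer_quiver G) e_ortho e_sum src_y y_tgt.
have pword s : p (word K s) =
    (\prod_(a <- map am s) lam a) *: \prod_(a <- map am s) x a.
  by rewrite path_morphism_word prod_scale !big_map.
have prun a n : p (word K (traject (@bnext G) a n)) =
    (\prod_(a <- traject nxt (am a) n) lam a) *: \prod_(a <- traject nxt (am a) n) x a.
  by rewrite pword amap_run.
have am_len a : blen a = len (am a) by rewrite [RHS]amap_len.
pose J : set (path_alg K (brauer_quiver G)) := [set t | p t = 0].
have JP : is_ideal J.
  split; first split; rewrite /J /=; first exact: rmorph0.
  - by move=> t u /= t0 u0; rewrite rmorphD /= t0 u0 addr0.
  - by move=> t u /= u0; rewrite rmorphM /= u0 mulr0.
  - by move=> t u /= u0; rewrite rmorphM /= u0 mul0r.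
(* The rescaling was chosen to make the form one on every socle path. *)
have fp a : f (p (word K (traject (@bnext G) a (blen a)))) = 1.
  by rewrite prun am_len lamP linearZ /= mulVf.
have J_eq a b : src a = src b -> J (word K (traject (@bnext G) a (blen a)) -
    word K (traject (@bnext G) b (blen b))).
  move=> ab; rewrite /J /= rmorphB /= !prun !am_len !lamP.
  apply/eqP; rewrite subr_eq0; apply/eqP.
  have := @line (am a) (am b); rewrite !src_am => /(_ ab).
  move=> /(congr1 (fun z => (f (\prod_(c <- traject nxt (am a) (len (am a))) x c))^-1 *:
     ((f (\prod_(c <- traject nxt (am b) (len (am b))) x c))^-1 *: z))).
  rewrite !scalerA -!mulrA mulVf // mulr1.
  by rewrite [X in X *: _ = _]mulrCA mulVf // mulr1 => ->.
have J_long a : J (word K (traject (@bnext G) a (blen a).+1)).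
  by rewrite -[J _]/(p _ = 0) prun am_len long0 scaler0.
have J_turn a b : b != bnext a -> J (arr K a * arr K b).
  move=> ab; rewrite /J /= rmorphM /= !path_morphism_arr /y -scalerAl -scalerAr.
  rewrite turn0 ?scaler0 // -am_next; apply: contra ab => /eqP /amap_inj ->.
  exact: eqxx.
have J_soc a : ~ J (word K (traject (@bnext G) a (blen a))).
  by move=> Ja; have := fp a; rewrite Ja linear0 => /esym/eqP; rewrite oner_eq0.
have JE : J = brauer_ideal K G :> set _.
  rewrite brauer_idealE; apply/seteqP; split.
    exact: (sub_form_rad (@tgt_bnext G) (@blen_bnext G) (@iter_blen G) (@blen_gt1 G)
      JP (@src_bout G) J_eq J_long J_turn J_soc).
  exact: (form_rad_sub (@tgt_bnext G) (@blen_bnext G) (@iter_blen G) (@blen_gt1 G)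
      JP (@src_bout G) J_eq J_long J_turn).
exists G; apply: alg_iso_sym; apply: (quot_iso (p := p)).
  by move=> t; rewrite -[ideal_set _]JE.
apply: span => [_ _ [t <-] [u <-]|k _ [t <-]|v s].
- by exists (t + u); rewrite rmorphD.
- by exists (k *: t); rewrite linearZ.
have [t <-] : exists t, p t = \prod_(a <- s) x a.
  elim: s => [|a s [t tE]]; first by exists 1; rewrite big_nil rmorph1.
  have [b bE] := amap_surj len_nxt iter_len len_gt1 out_ex a.
  exists ((lam a)^-1 *: (arr K b * t)); rewrite big_cons -tE linearZ /= rmorphM /=.
  by rewrite path_morphism_arr /y /am bE scalerAl scalerA mulVf // scale1r.
by exists (@idem K (brauer_quiver G) v * t); rewrite rmorphM /= path_morphism_idem.
Qed.

End BrauerPresentation.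

(** Admissibility supplies what the abstract argument assumes: idempotents and
    arrows are nonzero, no arrow is a multiple of another one, and long
    products vanish. *)
Lemma symmetric_multiserial_brauer (K : closedFieldType) (Q : quiver)
    (I : two_sided_ideal (path_alg K Q)) :
  admissible I -> multiserial_cond I -> symmetric_alg (quot_alg I) ->
  indecomposable (quot_alg I) ->
  (exists a b, ~ ideal_set I (arr K a * arr K b)) ->
  exists G, alg_iso (quot_alg I) (brauer_alg K G).
Proof.
move=> adm ser [f [fC fJ]] indec rad2.
pose e v := qpr I (idem K v); pose x a := qpr I (arr K a).
have I2 y (p : qpath Q) : ideal_set I y -> (size p.2 < 2)%N -> y@_p = 0.
  by move=> /(admissible_long2 adm); apply.
have e_ortho v w : e v * e w = (v == w)%:R *: e v.
  by rewrite /e -rmorphM /= idemM linearZ.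
have e_sum : \sum_v e v = 1 by rewrite -rmorph_sum /= idem_sum rmorph1.
have src_x a : e (src a) * x a = x a.
  by rewrite /e -rmorphM /= idem_arr eqxx scale1r.
have x_tgt a : x a * e (tgt a) = x a.
  by rewrite /e -rmorphM /= arr_idem eqxx scale1r.
have px s : \prod_(a <- s) x a = qpr I (word K s) by rewrite rmorph_prod.
have span (P : quot_alg I -> Prop) :
  (forall y z, P y -> P z -> P (y + z)) -> (forall k z, P z -> P (k *: z)) ->
  (forall v s, P (e v * \prod_(a <- s) x a)) -> forall z, P z.
  move=> PD PZ Pp z; rewrite -(qreprE z); move: (qrepr z).
  elim/path_alg_ind => [|y y' Py Py'|k y Py|p].
  - have /card_gt0P[v _] := qvert_gt0 Q.
    by rewrite rmorph0 -(scale0r (e v * \prod_(a <- [::]) x a)); exact: PZ.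
  - by rewrite rmorphD; exact: PD.
  - by rewrite linearZ; exact: PZ.
  - by rewrite path_eltE rmorphM /= -px; exact: Pp.
have nz a b : x a * x b != 0 <-> ~ ideal_set I (arr K a * arr K b).
  by rewrite -rmorphM /= -qpr_eq0; split=> /eqP.
have [nxt [len cs]] : exists nxt len, cycle_structure x f nxt len.
  have e_neq0 v : e v != 0.
    apply/eqP => /qpr_eq0/(I2 _ (triv_path v))/(_ isT)/eqP.
    by rewrite path_elt_coef eqxx oner_eq0.
  have x_neq0 a : x a != 0.
    apply/eqP => /qpr_eq0/(I2 _ (arrow_path a))/(_ isT)/eqP.
    by rewrite path_elt_coef eqxx oner_eq0.
  have x_min a b z : x a = x b * z -> a = b.
    rewrite -(qreprE z) -rmorphM => /eqP; rewrite -subr_eq0 -rmorphB => /eqP.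
    move=> /qpr_eq0/(I2 _ (arrow_path a))/(_ isT)/eqP; rewrite mcoeffB path_elt_coef eqxx.
    move: (qrepr z) => {}z; suff zE : b != a -> (arr K b * z)@_(arrow_path a) = 0.
      by have [//|/zE->] := eqVneq b a; rewrite subr0 oner_eq0.
    move=> ba; elim/path_alg_ind: z => [|y y' Py Py'|k y Py|q].
    - by rewrite mulr0 mcoeff0.
    - by rewrite mulrDr mcoeffD Py Py' addr0.
    - by rewrite -scalerAr pa_coefZ Py mulr0.
    have [bq|bq] := eqVneq (tgt b) (pstart q); last first.
      by rewrite [_ * _](@path_eltM0 K Q (arrow_path b)) // mcoeff0.
    have [r -> vr] := @path_eltM_cat K Q (arrow_path b) q bq.
    rewrite path_elt_coef; case: eqP => // ra; case/eqP: ba.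
    by move: vr; rewrite ra /= => -[_ ->].
  have nilp : exists N, forall s, (N <= size s)%N -> \prod_(a <- s) x a = 0.
    have [[N _ NI] _] := adm; exists N => s Ns; rewrite px; apply/qpr_eq0/NI.
    exact: word_arrow_exp.
  have ser_r a b c : x a * x b != 0 -> x a * x c != 0 -> b = c.
    by move=> /nz ab /nz ac; exact: (ser a).1 ab ac.
  have rad2' : exists a b, x a * x b != 0.
    by have [a [b /nz ab]] := rad2; exists a, b.
  have cs := symmetric_cycle_structure e_ortho e_neq0 src_x x_tgt x_neq0 x_min
    span nilp ser_r fC fJ indec rad2'.
  do 2 eexists; exact: cs.
exact: brauer_presentation e_ortho e_sum src_x x_tgt span cs.
Qed.

(** Elements of the radical are classes of combinations of nontrivial paths, so a
    product of two of them only involves paths of length at least two. *)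
Lemma arrow_products_rad2 (K : fieldType) (A : algType K) (Q : quiver)
    (I : two_sided_ideal (path_alg K Q)) :
  admissible I -> alg_iso A (quot_alg I) ->
  (forall a b, ideal_set I (arr K a * arr K b)) ->
  ideal_exp (@jacobson_rad A) 2 = [set 0].
Proof.
move=> adm /alg_isoP[g [h [gK hK]]] arr2.
have IP := ideal_setP I.
have long2 : @long K Q 2 `<=` I.
  apply: long_sub => // p lt_p; rewrite path_eltE; apply: (ideal_mull IP).
  case: (p.2) lt_p => [|a [|b s]] // _.
  by rewrite !word_cons mulrA; exact: (ideal_mulr IP).
have rad_long y : @jacobson_rad A y -> long 1 (qrepr (g y)).
  move=> yr; apply: (@vertex_char_eq0 K Q I adm) => v; rewrite qreprE.
  exact: (jacobson_rad_char (vertex_char adm v \o g)).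
have rad_mul y z : @jacobson_rad A y -> @jacobson_rad A z -> y * z = 0.
  move=> /rad_long y1 /rad_long z1; apply: (can_inj gK); rewrite rmorphM /= rmorph0.
  rewrite -(qreprE (g y)) -(qreprE (g z)) -rmorphM; apply/qpr_eq0/long2.
  exact: longM y1 z1.
apply/seteqP; split=> [_ [s [sJ ->]]|_ ->]; last first.
  by exists [::]; rewrite big_nil.
rewrite /= big_seq big1 // => u /sJ[u1 [t [tJ ->]]]; rewrite mulr_sumr big_seq.
by rewrite big1 // => w /tJ[w1 _]; rewrite mulrA (rad_mul u.1) ?mul0r.
Qed.

Theorem theoremB (K : closedFieldType) (Q : quiver)
    (I : two_sided_ideal (path_alg K Q)) (A : algType K := quot_alg I) :
  admissible I ->
  finite_dim A ->
  indecomposable A ->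
  ideal_exp (@jacobson_rad A) 2 <> [set 0] ->
  (symmetric_alg A /\ special_multiserial A) <->
  exists G : brauer_config, alg_iso A (brauer_alg K G).
Proof.
move=> adm _ indec rad2; split=> [[symA [Q' [I' [adm' ser' mor]]]]|[G AG]].
  have AB : alg_iso A (quot_alg I').
    apply: morita_basic_iso mor; exact: admissible_split_basic.
  have [G BG] : exists G, alg_iso (quot_alg I') (brauer_alg K G).
    apply: symmetric_multiserial_brauer => //.
    - exact: symmetric_iso AB symA.
    - exact: indecomposable_iso AB indec.
    apply: contrapT => no_prod; apply: rad2.
    apply: (arrow_products_rad2 adm' AB) => a b.
    by apply: contrapT => nab; apply: no_prod; exists a, b.
  by exists G; exact: alg_iso_trans AB BG.
split; first exact: symmetric_iso (alg_iso_sym AG) (brauer_symmetric K G).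
exists (brauer_quiver G), (brauer_ideal K G); split.
- exact: brauer_admissible.
- exact: brauer_multiserial.
- exact: alg_iso_morita.
Qed.
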